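(* Let $\lambda\in\mathbb{C}$ and suppose that there exists a function $f\in C^\infty([0,1])$ (complex-valued), not identically zero, that satisfies $$-(1-\rho^2)f''(\rho)-\frac{2}{\rho}f'(\rho)+2(\lambda+1)\rho f'(\rho)+\frac{2\cos(4\arctan(\rho))}{\rho^2}f(\rho)+\lambda(\lambda+1)f(\rho)=0$$ for all $\rho\in(0,1)$. Then $\operatorname{Re}\lambda<0$ or $\lambda=1$. (That is, the self-similar blowup solution $u^T(t,r)=2\arctan(\frac{r}{T-t})$ of the corotational wave maps equation is mode stable.)
   Context: The corotational wave maps equation is $(\partial_t^2-\partial_r^2-\frac{2}{r}\partial_r)u(t,r)+\frac{\sin(2u(t,r))}{r^2}=0$. In the similarity coordinates $\tau=-\log(T-t)+\log T$, $\rho=\frac{r}{T-t}$, the solution $u^T$ becomes the static solution $2\arctan(\rho)$; the ODE in the claim is the linearized equation obtained from the ansatz $2\arctan(\rho)+e^{\lambda\tau}f(\rho)$. Mode stability of $u^T$ means, by definition, that the existence of a nontrivial $f\in C^\infty([0,1])$ solving this ODE implies $\operatorname{Re}\lambda<0$ or $\lambda=1$. Note $2\cos(4\arctan\rho)=2\frac{1-6\rho^2+\rho^4}{(1+\rho^2)^2}$. *)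

(* Defs.v *)
From Stdlib Require Import Reals.
From Coquelicot Require Import Coquelicot.

Open Scope R_scope.

(* Derivative of a complex-valued function of one real variable relative to a
   set [D]: Coquelicot's [is_derive] with the neighbourhood filter of [x]
   replaced by its trace on [D].  For [D = [a,b]] it is the ordinary derivative
   at interior points and the one-sided derivative at [a] and [b]. *)
Definition is_derive_within (D : R -> Prop) (f : R -> C) (x : R) (l : C) : Prop :=
  filterdiff (K := R_AbsRing) (U := R_NormedModule) (V := C_R_NormedModule)
    f (within D (locally x)) (fun h : R => scal h l).

(* [f] belongs to C^oo([a,b]): [g n] is the n-th derivative of [f] on the closed
   interval.  The values of [f] outside [a,b] play no role. *)
Definition smooth_on_Icc (a b : R) (f : R -> C) : Prop :=
  exists g : nat -> R -> C,
    (forall x : R, a <= x <= b -> g 0%nat x = f x) /\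
    (forall (n : nat) (x : R), a <= x <= b ->
       is_derive_within (fun y : R => a <= y <= b) (g n) x (g (S n) x)).

(* Coquelicot's [Derive] is only for real-valued functions, and its [C_derive]
   is the holomorphic derivative; here the variable is real. *)
Definition Derive_RC (f : R -> C) (x : R) : C :=
  (Derive (fun t : R => Re (f t)) x, Derive (fun t : R => Im (f t)) x).

(* Main.v *)
(** Multiply the equation by the adjoint weight and integrate against z^n, where
    z = 2 rho^2 / (1 + rho^2): the resulting moments N_n of a smooth solution, regularised at rho = 1
    in the sense of Hadamard because the weight behaves like (1 - rho)^(lambda - 1), satisfy a
    three-term recurrence with characteristic roots 1 and 2, and their second differences are bounded.
    The recurrence starts from a single free parameter N_0.  With m = lambda + 2 n, the ratios
    w_n = (m - 1) (m + 5) N_(n+1) / ((m + 1) N_n) satisfy, up to small corrections,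
    w_n = lambda + 6 n + 7 - (8 n^2 + 12 n) / w_(n-1).  For Re lambda >= 0 this map preserves lower
    bounds of the form Re w_n >= 3 n + 4, so the N_n grow geometrically unless all of them vanish.
    Hence they vanish, and since the polynomials in z are dense the solution is zero.  For
    lambda = 0 the regularised moments lose their information at rho = 1 (they carry a factor lambda);
    there a Sturm comparison with the eigenfunction rho / (1 + rho^2) of lambda = 1 applies. *)
Require Import Defs.
From Stdlib Require Import Reals.
From Coquelicot Require Import Coquelicot.
From Stdlib Require Import Lra Lia Psatz Classical.

(** * The three-term recurrence *)

Ltac expand_RtoC :=
  repeat first [ rewrite RtoC_plus | rewrite RtoC_minus | rewrite RtoC_mult | rewrite RtoC_pow ].

Lemma Re_le_Cmod (z : C) : Re z <= Cmod z.
Proof. apply Rle_trans with (1 := Rle_abs _). apply re_le_Cmod. Qed.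

Lemma re_minus (a b : C) : Re (a - b) = Re a - Re b.
Proof. reflexivity. Qed.

Lemma neq0_of_Re_pos (z : C) : 0 < Re z -> z <> 0.
Proof. intros H E. rewrite E in H. simpl in H. lra. Qed.

Lemma Cmod_quotient_bound (m : C) (nu : R) :
  4 <= nu -> 2 * nu <= Re m ->
  Cmod (m * m - 9) <= (1 + / (3 * nu ^ 2)) * Cmod (m * m - 1).
Proof.
  intros Hnu Hm.
  assert (Heps : 0 < / (3 * nu ^ 2)) by (apply Rinv_0_lt_compat; nra).
  apply Rsqr_incr_0_var.
  2: { apply Rmult_le_pos; [lra | apply Cmod_ge_0]. }
  unfold Rsqr.
  replace (Cmod (m * m - 9) * Cmod (m * m - 9)) with (Cmod (m * m - 9) ^ 2) by ring.
  replace ((1 + / (3 * nu ^ 2)) * Cmod (m * m - 1) * ((1 + / (3 * nu ^ 2)) * Cmod (m * m - 1)))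
    with ((1 + / (3 * nu ^ 2)) ^ 2 * Cmod (m * m - 1) ^ 2) by ring.
  rewrite !Cmod2_alt. destruct m as [a y]. simpl in *.
  set (eps := / (3 * (nu * (nu * 1)))) in *.
  assert (Heps' : 4 <= 3 * a ^ 2 * eps).
  { unfold eps. apply Rmult_le_reg_r with (3 * (nu * (nu * 1))); [nra|].
    rewrite Rmult_assoc, Rinv_l by nra. nra. }
  assert (Ha : 64 <= a ^ 2) by nra.
  assert (Hy : 0 <= y ^ 2) by nra.
  set (A := a ^ 2) in *. set (Y := y ^ 2) in *.
  set (U := (A - Y - 1) ^ 2 + 4 * A * Y).
  assert (HU : 0 <= U) by (unfold U; assert (0 <= (A - Y - 1) ^ 2) by apply pow2_ge_0; nra).
  (* [eps >= 4 / (3 a^2)] reduces the claim to a quadratic in [y^2] of negative discriminant. *)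
  assert (HeU : 8 * U <= 3 * A * (2 * eps * U)).
  { replace (3 * A * (2 * eps * U)) with (3 * A * eps * (2 * U)) by ring.
    replace (8 * U) with (4 * (2 * U)) by ring.
    apply Rmult_le_compat_r; lra. }
  assert (Hq : 3 * A * (80 - 16 * (A - Y)) <= 8 * U).
  { unfold U. assert (0 <= (Y - 2 * A) ^ 2) by apply pow2_ge_0. nra. }
  assert (Hm2 : 80 - 16 * (A - Y) <= 2 * eps * U).
  { apply Rmult_le_reg_l with (3 * A); lra. }
  assert (He2 : 0 <= eps ^ 2 * U) by (apply Rmult_le_pos; [apply pow2_ge_0 | exact HU]).
  match goal with |- ?L <= _ => replace L with (U + (80 - 16 * (A - Y))) by (unfold U, A, Y; ring) end.
  match goal with |- _ <= ?L => replace L with (U + 2 * eps * U + eps ^ 2 * U) by (unfold U, A, Y; ring) end.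
  lra.
Qed.

Lemma Re_ratio_lower_bound (l w w' : C) (nu K : R) :
  0 <= Re l -> 4 <= nu -> 0 < K -> K <= Re w' ->
  (w = l + RtoC (6 * nu + 7) - 16 / (l + RtoC (2 * nu) + 1)
       - RtoC (4 * nu * (2 * nu + 3)) *
         (((l + RtoC (2 * nu)) * (l + RtoC (2 * nu)) - 9) /
          (((l + RtoC (2 * nu)) * (l + RtoC (2 * nu)) - 1) * w')))%C ->
  6 * nu + 7 - 16 / (2 * nu + 1)
    - 4 * nu * (2 * nu + 3) * (1 + / (3 * nu ^ 2)) / K <= Re w.
Proof.
  intros Hl Hnu HK Hw' Hw.
  set (m := (l + RtoC (2 * nu))%C) in *.
  assert (Hm : 2 * nu <= Re m) by (unfold m; destruct l; simpl in *; lra).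
  assert (Hm1 : 2 * nu + 1 <= Cmod (m + 1)).
  { eapply Rle_trans; [|apply Re_le_Cmod]. rewrite re_plus, re_RtoC. lra. }
  assert (Hm2 : 2 * nu - 1 <= Cmod (m - 1)).
  { eapply Rle_trans; [|apply Re_le_Cmod].
    destruct m; simpl in *. lra. }
  assert (Hmm : (m * m - 1 = (m + 1) * (m - 1))%C) by ring.
  assert (Hp : 0 < Cmod (m * m - 1)).
  { rewrite Hmm, Cmod_mult. apply Rmult_lt_0_compat; lra. }
  assert (Hw'0 : K <= Cmod w') by (eapply Rle_trans; [|apply Re_le_Cmod]; lra).
  assert (H1 : Re (16 / (m + 1)) <= 16 / (2 * nu + 1)).
  { eapply Rle_trans; [apply Re_le_Cmod|].
    rewrite Cmod_div by (apply Cmod_gt_0; lra).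
    rewrite Cmod_R, Rabs_pos_eq by lra.
    apply Rmult_le_compat_l; [lra|]. apply Rinv_le_contravar; lra. }
  assert (H2 : Re ((m * m - 9) / ((m * m - 1) * w')) <= (1 + / (3 * nu ^ 2)) / K).
  { eapply Rle_trans; [apply Re_le_Cmod|].
    rewrite Cmod_div by (apply Cmult_neq_0; apply Cmod_gt_0; lra).
    rewrite Cmod_mult.
    assert (Hb := Cmod_quotient_bound m nu Hnu Hm).
    apply Rmult_le_reg_r with (Cmod (m * m - 1) * Cmod w'); [nra|].
    unfold Rdiv. rewrite Rmult_assoc, Rinv_l by nra.
    rewrite Rmult_1_r. eapply Rle_trans; [exact Hb|].
    assert (0 < / (3 * nu ^ 2)) by (apply Rinv_0_lt_compat; nra).
    assert (1 <= / K * Cmod w').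
    { apply Rmult_le_reg_l with K; [lra|]. rewrite <- Rmult_assoc, Rinv_r by lra. lra. }
    replace ((1 + / (3 * nu ^ 2)) * / K * (Cmod (m * m - 1) * Cmod w'))
      with ((1 + / (3 * nu ^ 2)) * Cmod (m * m - 1) * (/ K * Cmod w')) by ring.
    rewrite <- (Rmult_1_r (_ * _)) at 1.
    apply Rmult_le_compat_l; [apply Rmult_le_pos; lra | assumption]. }
  rewrite Hw, !re_minus, re_plus, re_scal_l, re_RtoC.
  assert (0 <= 4 * nu * (2 * nu + 3)) by nra.
  assert (H3 := Rmult_le_compat_l _ _ _ H H2).
  unfold Rdiv in *. rewrite <- Rmult_assoc in H3. lra.
Qed.

Lemma recurrence_ratio_start (l N0 N1 N2 N3 N4 : C) :
  0 <= Re l -> l <> 1 -> N0 <> 0 ->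
  ((l - 1) * (l + 5) * N1 = (l - 1) * (l + 9) * N0)%C ->
  ((l + 1) * (l + 7) * N2 = (l * l + 16 * l + 23) * N1 - 20 * N0)%C ->
  ((l + 3) * (l + 9) * N3 = (l * l + 24 * l + 79) * N2 - 56 * N1)%C ->
  ((l + 5) * (l + 11) * N4 = (l * l + 32 * l + 159) * N3 - 108 * N2)%C ->
  N3 <> 0 /\ 68 / 5 <= Re ((l + 5) * (l + 11) / (l + 7) * (N4 / N3))%C.
Proof.
  intros Hl Hl1 HN0 R0 R1 R2 R3.
  assert (Hp : forall c : R, 0 < c -> (l + c <> 0)%C).
  { intros c Hc. apply neq0_of_Re_pos. rewrite re_plus, re_RtoC. lra. }
  assert (H1 := Hp 1 ltac:(lra)). assert (H3 := Hp 3 ltac:(lra)).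
  assert (H5 := Hp 5 ltac:(lra)). assert (H7 := Hp 7 ltac:(lra)).
  assert (H9 := Hp 9 ltac:(lra)). assert (H11 := Hp 11 ltac:(lra)).
  assert (Hlm : (l - 1 <> 0)%C) by (apply Cminus_eq_contra; exact Hl1).
  set (c := (N0 / (l + 5))%C).
  assert (Hc : c <> 0).
  { intro E. apply HN0. replace N0 with (c * (l + 5))%C by (unfold c; field; exact H5).
    rewrite E. ring. }
  assert (E0 : N0 = ((l + 5) * c)%C) by (unfold c; field; exact H5).
  assert (E1 : N1 = ((l + 9) * c)%C).
  { unfold c. replace N1 with (((l - 1) * (l + 5) * N1) / ((l - 1) * (l + 5)))%C by (field; auto).
    rewrite R0. field; auto. }
  set (Q2 := (l ^ 5 + 49 * l ^ 4 + 770 * l ^ 3 + 4658 * l ^ 2 + 9757 * l + 4925)%C).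
  set (Q3 := (l ^ 7 + 81 * l ^ 6 + 2389 * l ^ 5 + 33093 * l ^ 4 + 230051 * l ^ 3
              + 782803 * l ^ 2 + 1141639 * l + 471063)%C).
  assert (E2 : N2 = ((l ^ 3 + 25 * l ^ 2 + 147 * l + 107) * c / ((l + 1) * (l + 7)))%C).
  { replace N2 with ((l + 1) * (l + 7) * N2 / ((l + 1) * (l + 7)))%C by (field; auto).
    rewrite R1, E1, E0. field; auto. }
  assert (E3 : N3 = (Q2 * c / ((l + 1) * (l + 7) * (l + 3) * (l + 9)))%C).
  { replace N3 with ((l + 3) * (l + 9) * N3 / ((l + 3) * (l + 9)))%C by (field; auto).
    rewrite R2, E1, E2. unfold Q2. field; auto. }
  assert (E4 : N4 = (Q3 * c / ((l + 1) * (l + 7) * (l + 3) * (l + 9) * (l + 5) * (l + 11)))%C).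
  { replace N4 with ((l + 5) * (l + 11) * N4 / ((l + 5) * (l + 11)))%C by (field; auto).
    rewrite R3, E3, E2. unfold Q2, Q3. field; repeat split; auto. }
  set (D := ((l + 7) * Q2)%C).
  (* Expanded in [Re l] and [(Im l)^2], the difference of the two sides has positive coefficients only. *)
  assert (Hpos : 0 < Re (Q3 * Cconj D) - 68 / 5 * (Re D ^ 2 + Im D ^ 2)).
  { unfold D, Q2, Q3. clear - Hl. destruct l as [x y]. simpl in Hl.
    assert (Hy : forall k : nat, 0 <= y ^ (2 * k)).
    { intro k. rewrite pow_mult. apply pow_le, pow2_ge_0. }
    cbn -[Rplus Rmult Ropp Rdiv pow].
    apply Rmult_lt_reg_l with 5; [lra|]. rewrite Rmult_0_r. field_simplify.
    apply Rplus_le_lt_0_compat; [|lra].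
    repeat first [ lra | apply pow_le, Hl | exact (Hy 1%nat) | exact (Hy 2%nat) | exact (Hy 3%nat)
                 | exact (Hy 4%nat) | exact (Hy 5%nat) | exact (Hy 6%nat)
                 | apply Rplus_le_le_0_compat | apply Rmult_le_pos ]. }
  assert (HD : D <> 0).
  { intro E. rewrite E in Hpos. simpl in Hpos. lra. }
  assert (HQ2 : Q2 <> 0).
  { intro E. apply HD. unfold D. rewrite E. ring. }
  split.
  - rewrite E3. intro E. apply (Cmult_neq_0 _ _ HQ2 Hc).
    replace (Q2 * c)%C with (Q2 * c / ((l + 1) * (l + 7) * (l + 3) * (l + 9)) * ((l + 1) * (l + 7) * (l + 3) * (l + 9)))%C
      by (field; auto).
    rewrite E. ring.
  - replace ((l + 5) * (l + 11) / (l + 7) * (N4 / N3))%C with (Q3 / D)%C.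
    2: { rewrite E3, E4. unfold D. field; repeat split; auto. }
    assert (HDD : 0 < Re D ^ 2 + Im D ^ 2).
    { rewrite <- Cmod2_alt. apply pow_lt, Cmod_gt_0, HD. }
    replace (Re (Q3 / D)%C) with (Re (Q3 * Cconj D) / (Re D ^ 2 + Im D ^ 2)).
    2: { destruct Q3 as [q1 q2], D as [d1 d2]. simpl in *. field. nra. }
    apply Rmult_le_reg_r with (1 := HDD). unfold Rdiv. rewrite Rmult_assoc.
    rewrite (Rmult_assoc _ (/ _)), Rinv_l by lra. unfold Rdiv in Hpos. lra.
Qed.

Lemma recurrence_ratio_step (l : C) (nu : R) (N0 N1 N2 : C) :
  0 <= Re l -> 4 <= nu -> N0 <> 0 -> N1 <> 0 ->
  let m := (l + RtoC (2 * nu))%C in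
  ((m - 1) * (m + 5) * N2 =
   (l * l + RtoC (8 * nu + 8) * l + RtoC (12 * nu ^ 2 + 20 * nu - 9)) * N1
   - RtoC (4 * nu * (2 * nu + 3)) * N0)%C ->
  forall K : R, 0 < K -> K <= Re ((m - 3) * (m + 3) / (m - 1) * (N1 / N0))%C ->
  6 * nu + 7 - 16 / (2 * nu + 1)
    - 4 * nu * (2 * nu + 3) * (1 + / (3 * nu ^ 2)) / K
  <= Re ((m - 1) * (m + 5) / (m + 1) * (N2 / N1))%C.
Proof.
  intros Hl Hnu HN0 HN1 m Hrec K HK Hw.
  assert (Hm : 8 <= Re m) by (unfold m; rewrite re_plus, re_RtoC; lra).
  assert (Hp : forall c : R, -8 < c -> (m + c <> 0)%C).
  { intros c Hc. apply neq0_of_Re_pos. rewrite re_plus, re_RtoC. lra. }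
  assert (H1 := Hp 1 ltac:(lra)). assert (H3 := Hp 3 ltac:(lra)).
  assert (H5 : (m - 1 <> 0)%C).
  { apply neq0_of_Re_pos. rewrite re_minus, re_RtoC. lra. }
  assert (H6 : (m - 3 <> 0)%C).
  { apply neq0_of_Re_pos. rewrite re_minus, re_RtoC. lra. }
  eapply Re_ratio_lower_bound with (l := l); [assumption | assumption | exact HK | exact Hw |].
  fold m.
  replace ((m - 1) * (m + 5) / (m + 1) * (N2 / N1))%C
    with (((m - 1) * (m + 5) * N2) / ((m + 1) * N1))%C by (field; auto).
  rewrite Hrec.
  assert (Hmm : (m * m - 1 <> 0)%C).
  { replace (m * m - 1)%C with ((m + 1) * (m - 1))%C by ring. apply Cmult_neq_0; assumption. }
  assert (El : l = (m - RtoC (2 * nu))%C) by (unfold m; ring).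
  rewrite El. clearbody m.
  expand_RtoC.
  field. repeat split; auto.
Qed.

Definition mode_recurrence (l : C) (N : nat -> C) : Prop :=
  ((l - 1) * (l + 5) * N 1%nat = (l - 1) * (l + 9) * N 0%nat)%C /\
  forall n : nat,
    let nu := INR (S n) in
    let m := (l + RtoC (2 * nu))%C in
    ((m - 1) * (m + 5) * N (S (S n)) =
     (l * l + RtoC (8 * nu + 8) * l + RtoC (12 * nu ^ 2 + 20 * nu - 9)) * N (S n)
     - RtoC (4 * nu * (2 * nu + 3)) * N n)%C.

Lemma mode_recurrence_zero (l : C) (N : nat -> C) :
  0 <= Re l -> l <> 1 -> mode_recurrence l N -> N 0%nat = 0 -> forall n, N n = 0.
Proof.
  intros Hl Hl1 [R0 RS] H0.
  assert (H1 : N 1%nat = 0).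
  { assert (Hlm : (l - 1 <> 0)%C) by (apply Cminus_eq_contra; exact Hl1).
    assert (H5 : (l + 5 <> 0)%C) by (apply neq0_of_Re_pos; rewrite re_plus, re_RtoC; lra).
    replace (N 1%nat) with ((l - 1) * (l + 5) * N 1%nat / ((l - 1) * (l + 5)))%C by (field; auto).
    rewrite R0, H0. field; auto. }
  assert (H : forall n, N n = 0 /\ N (S n) = 0).
  { induction n as [|n [IH1 IH2]]; [auto|]. split; [exact IH2|].
    specialize (RS n). cbv zeta in RS. rewrite IH1, IH2 in RS.
    assert (Hnu : 1 <= INR (S n)) by (rewrite S_INR; pose proof (pos_INR n); lra).
    set (m := (l + RtoC (2 * INR (S n)))%C) in *.
    assert (Hm : 2 <= Re m) by (unfold m; rewrite re_plus, re_RtoC; lra).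
    assert (H3 : (m - 1 <> 0)%C) by (apply neq0_of_Re_pos; rewrite re_minus, re_RtoC; lra).
    assert (H5 : (m + 5 <> 0)%C) by (apply neq0_of_Re_pos; rewrite re_plus, re_RtoC; lra).
    replace (N (S (S n))) with ((m - 1) * (m + 5) * N (S (S n)) / ((m - 1) * (m + 5)))%C
      by (field; auto).
    rewrite RS. field; auto. }
  intro n. apply H.
Qed.

Lemma recurrence_bound_increase (nu : R) :
  7 <= nu ->
  3 * nu + 4 <= 6 * nu + 7 - 16 / (2 * nu + 1)
    - 4 * nu * (2 * nu + 3) * (1 + / (3 * nu ^ 2)) / (3 * (nu - 1) + 4).
Proof.
  intro H.
  assert (H1 : 16 / (2 * nu + 1) <= 16 / 15).
  { apply Rmult_le_compat_l; [lra|]. apply Rinv_le_contravar; lra. }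
  assert (H2 : / (3 * nu ^ 2) <= / 147) by (apply Rinv_le_contravar; nra).
  assert (H3 : 4 * nu * (2 * nu + 3) * (1 + / (3 * nu ^ 2)) / (3 * (nu - 1) + 4)
               <= 3 * nu + 29 / 15).
  { apply Rmult_le_reg_r with (3 * (nu - 1) + 4); [lra|].
    unfold Rdiv. rewrite Rmult_assoc, Rinv_l, Rmult_1_r by lra.
    apply Rle_trans with (4 * nu * (2 * nu + 3) * (1 + / 147)); [|nra].
    apply Rmult_le_compat_l; nra. }
  lra.
Qed.

Lemma mode_recurrence_ratio (l : C) (N : nat -> C) :
  0 <= Re l -> l <> 1 -> mode_recurrence l N -> N 0%nat <> 0 ->
  forall n, (6 <= n)%nat ->
    let m := (l + RtoC (2 * INR n))%C in
    N n <> 0 /\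
    3 * INR n + 4 <= Re ((m - 1) * (m + 5) / (m + 1) * (N (S n) / N n))%C.
Proof.
  intros Hl Hl1 [R0 RS] H0.
  assert (Hstart : N 3%nat <> 0 /\
    68 / 5 <= Re ((l + 5) * (l + 11) / (l + 7) * (N 4%nat / N 3%nat))%C).
  { apply (recurrence_ratio_start l (N 0%nat) (N 1%nat) (N 2%nat)); auto.
    - pose proof (RS 0%nat) as R1. cbv zeta in R1. cbn [INR] in R1. clear RS R0 H0 Hl1.
      replace ((l + 1) * (l + 7))%C with ((l + RtoC (2 * 1) - 1) * (l + RtoC (2 * 1) + 5))%C
        by (expand_RtoC; ring).
      rewrite R1. expand_RtoC. ring.
    - pose proof (RS 1%nat) as R1. cbv zeta in R1. cbn [INR] in R1. clear RS R0 H0 Hl1.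
      replace ((l + 3) * (l + 9))%C
        with ((l + RtoC (2 * (1 + 1)) - 1) * (l + RtoC (2 * (1 + 1)) + 5))%C
        by (expand_RtoC; ring).
      rewrite R1. expand_RtoC. ring.
    - pose proof (RS 2%nat) as R1. cbv zeta in R1. cbn [INR] in R1. clear RS R0 H0 Hl1.
      replace ((l + 5) * (l + 11))%C
        with ((l + RtoC (2 * (1 + 1 + 1)) - 1) * (l + RtoC (2 * (1 + 1 + 1)) + 5))%C
        by (expand_RtoC; ring).
      rewrite R1. expand_RtoC. ring. }
  set (P := fun (n : nat) (K : R) =>
    let m := (l + RtoC (2 * INR n))%C in
    N n <> 0 /\ K <= Re ((m - 1) * (m + 5) / (m + 1) * (N (S n) / N n))%C).
  assert (Hstep : forall n K nu, (3 <= n)%nat -> nu = INR (S n) -> 0 < K -> P n K ->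
    P (S n) (6 * nu + 7 - 16 / (2 * nu + 1)
             - 4 * nu * (2 * nu + 3) * (1 + / (3 * nu ^ 2)) / K)).
  { intros n K nu Hn Enu HK [Hn0 HnK]. cbv zeta in HnK. unfold P. cbv zeta. rewrite <- Enu.
    assert (Hnu : 4 <= nu).
    { rewrite Enu. replace 4 with (INR 4) by (simpl; ring). apply le_INR. lia. }
    assert (Em : (l + RtoC (2 * nu) = l + RtoC (2 * INR n) + 2)%C).
    { rewrite Enu, S_INR. expand_RtoC. ring. }
    assert (HN1 : N (S n) <> 0).
    { intro E. rewrite E in HnK. unfold Cdiv at 2 in HnK.
      rewrite !Cmult_0_l, Cmult_0_r in HnK. simpl in HnK. lra. }
    split; [exact HN1|].
    apply (recurrence_ratio_step l nu (N n) (N (S n)) (N (S (S n))) Hl Hnu Hn0 HN1); [|exact HK|].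
    - specialize (RS n). cbv zeta in RS. rewrite <- Enu in RS. exact RS.
    - rewrite Em. replace (l + RtoC (2 * INR n) + 2 - 3)%C with (l + RtoC (2 * INR n) - 1)%C by ring.
      replace (l + RtoC (2 * INR n) + 2 + 3)%C with (l + RtoC (2 * INR n) + 5)%C by ring.
      replace (l + RtoC (2 * INR n) + 2 - 1)%C with (l + RtoC (2 * INR n) + 1)%C by ring.
      exact HnK. }
  assert (Hmono : forall n K K', K' <= K -> P n K -> P n K').
  { intros n K K' HK [H1 H2]. split; [exact H1 | lra]. }
  assert (P3 : P 3%nat (68 / 5)).
  { destruct Hstart as [H3 H4]. split; [exact H3|].
    replace (l + RtoC (2 * INR 3) - 1)%C with (l + 5)%C by (simpl; expand_RtoC; ring).
    replace (l + RtoC (2 * INR 3) + 5)%C with (l + 11)%C by (simpl; expand_RtoC; ring).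
    replace (l + RtoC (2 * INR 3) + 1)%C with (l + 7)%C by (simpl; expand_RtoC; ring).
    exact H4. }
  assert (P4 : P 4%nat 16).
  { eapply Hmono; [|apply (Hstep 3%nat (68 / 5) 4); auto; simpl; lra]. lra. }
  assert (P5 : P 5%nat 19).
  { eapply Hmono; [|apply (Hstep 4%nat 16 5); auto; simpl; lra]. lra. }
  assert (P6 : P 6%nat 22).
  { eapply Hmono; [|apply (Hstep 5%nat 19 6); auto; simpl; lra]. lra. }
  intros n Hn. cbv zeta.
  change (P n (3 * INR n + 4)).
  induction Hn as [|n Hn IH]; [eapply Hmono; [|exact P6]; simpl; lra|].
  assert (Hnu : 7 <= INR (S n)).
  { replace 7 with (INR 7) by (simpl; ring). apply le_INR. lia. }
  eapply Hmono; [apply recurrence_bound_increase; exact Hnu|].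
  rewrite S_INR at 6.
  replace (INR n + 1 - 1) with (INR n) by ring.
  apply Hstep; [lia | reflexivity | pose proof (pos_INR n); lra | exact IH].
Qed.

Lemma mode_recurrence_growth (l : C) (N : nat -> C) :
  0 <= Re l -> l <> 1 -> mode_recurrence l N -> N 0%nat <> 0 ->
  exists n0 : nat, forall n, (n0 <= n)%nat ->
    0 < Cmod (N n) /\ 6 / 5 * Cmod (N n) <= Cmod (N (S n)).
Proof.
  intros Hl Hl1 HN H0.
  destruct (nfloor_ex (Rmax 6 (2 * Cmod l + 4))) as [k [Hk1 Hk2]].
  { apply Rle_trans with 6; [lra | apply Rmax_l]. }
  exists (S k). intros n Hn.
  assert (Hn' : Rmax 6 (2 * Cmod l + 4) <= INR n).
  { apply le_INR in Hn. rewrite S_INR in Hn. lra. }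
  assert (Hn6 := Rle_trans _ _ _ (Rmax_l _ _) Hn').
  assert (Hnl := Rle_trans _ _ _ (Rmax_r _ _) Hn').
  assert (H6 : (6 <= n)%nat).
  { apply INR_le. simpl. lra. }
  destruct (mode_recurrence_ratio l N Hl Hl1 HN H0 n H6) as [Hn0 HnK].
  set (m := (l + RtoC (2 * INR n))%C) in *.
  assert (Hpos : 0 < Cmod (N n)) by (apply Cmod_gt_0; exact Hn0).
  split; [exact Hpos|].
  assert (Hm : 12 <= Re m) by (unfold m; rewrite re_plus, re_RtoC; lra).
  assert (Hm1 : (m + 1 <> 0)%C) by (apply neq0_of_Re_pos; rewrite re_plus, re_RtoC; lra).
  assert (Hm5 : Cmod (m + 5) <= Cmod l + 2 * INR n + 5).
  { unfold m. eapply Rle_trans; [apply Cmod_triangle|].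
    rewrite (Cmod_R 5), (Rabs_pos_eq 5) by lra. apply Rplus_le_compat_r.
    eapply Rle_trans; [apply Cmod_triangle|].
    rewrite Cmod_R, Rabs_pos_eq by lra. lra. }
  assert (Hq : Cmod (m - 1) <= Cmod (m + 1)).
  { apply Rsqr_incr_0_var; [|apply Cmod_ge_0]. rewrite !Rsqr_pow2, !Cmod2_alt.
    destruct m as [a b]. simpl in *. nra. }
  assert (Hw := Rle_trans _ _ _ HnK (Re_le_Cmod _)).
  rewrite Cmod_mult, !Cmod_div, Cmod_mult in Hw by assumption.
  assert (Hp1 : 0 < Cmod (m + 1)) by (apply Cmod_gt_0; exact Hm1).
  assert (Hr : Cmod (m - 1) * Cmod (m + 5) / Cmod (m + 1) <= Cmod (m + 5)).
  { apply Rmult_le_reg_r with (1 := Hp1). unfold Rdiv.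
    rewrite Rmult_assoc, Rinv_l, Rmult_1_r by lra.
    rewrite (Rmult_comm (Cmod (m + 5))). apply Rmult_le_compat_r; [apply Cmod_ge_0 | exact Hq]. }
  set (t := Cmod (N (S n)) / Cmod (N n)) in *.
  assert (Ht : 0 <= t).
  { unfold t, Rdiv. apply Rmult_le_pos; [apply Cmod_ge_0 | left; apply Rinv_0_lt_compat; exact Hpos]. }
  assert (Ht2 : 6 / 5 <= t).
  { assert (3 * INR n + 4 <= (Cmod l + 2 * INR n + 5) * t).
    { eapply Rle_trans; [exact Hw|]. apply Rmult_le_compat_r; [exact Ht|]. lra. }
    pose proof (Cmod_ge_0 l). nra. }
  replace (Cmod (N (S n))) with (t * Cmod (N n)) by (unfold t; field; lra).
  apply Rmult_le_compat_r; lra.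
Qed.

Lemma no_geometric_growth (N : nat -> C) (M : R) (n0 : nat) :
  (forall n, Cmod (N n - 2 * N (S n) + N (S (S n)))%C <= M) ->
  ~ (forall n, (n0 <= n)%nat ->
      0 < Cmod (N n) /\ 6 / 5 * Cmod (N n) <= Cmod (N (S n))).
Proof.
  intros HM HG.
  assert (HM0 : 0 <= M) by (eapply Rle_trans; [apply Cmod_ge_0 | apply (HM 0%nat)]).
  set (D := fun n => (N (S n) - N n)%C).
  assert (HD : forall n, Cmod (D n) <= Cmod (D 0%nat) + INR n * M).
  { induction n as [|n IH]; [simpl; lra|]. rewrite S_INR.
    replace (D (S n)) with (D n + (N n - 2 * N (S n) + N (S (S n))))%C by (unfold D; ring).
    eapply Rle_trans; [apply Cmod_triangle|]. specialize (HM n). lra. }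
  assert (HN : forall n, (n0 <= n)%nat -> Cmod (N n) <= 5 * Cmod (D n)).
  { intros n Hn. destruct (HG n Hn) as [_ H].
    assert (Cmod (N (S n)) <= Cmod (D n) + Cmod (N n)).
    { replace (N (S n)) with (D n + N n)%C by (unfold D; ring). apply Cmod_triangle. }
    lra. }
  assert (Hexp : forall k, (6 / 5) ^ k * Cmod (N n0) <= Cmod (N (n0 + k)%nat)).
  { induction k as [|k IH]; [rewrite Nat.add_0_r; simpl; lra|].
    rewrite Nat.add_succ_r. destruct (HG (n0 + k)%nat) as [_ H]; [lia|]. simpl. lra. }
  assert (Hc : 0 < Cmod (N n0)) by (apply HG; lia).
  set (c := Cmod (N n0)) in *.
  set (A := 5 * (Cmod (D 0%nat) + INR n0 * M)).
  assert (HA : 0 <= A).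
  { unfold A. pose proof (Cmod_ge_0 (D 0%nat)). pose proof (pos_INR n0). nra. }
  assert (Hlin : forall k, (6 / 5) ^ k * c <= A + 5 * M * INR k).
  { intro k. eapply Rle_trans; [apply Hexp|]. eapply Rle_trans; [apply HN; lia|].
    specialize (HD (n0 + k)%nat). rewrite plus_INR in HD. unfold A. nra. }
  assert (Hsq : forall k, (INR k / 5) ^ 2 * c <= A + 10 * M * INR k).
  { intro k. specialize (Hlin (2 * k)%nat). rewrite mult_INR in Hlin. simpl (INR 2) in Hlin.
    rewrite Nat.mul_comm, pow_mult in Hlin.
    assert (Hk : INR k / 5 <= (6 / 5) ^ k).
    { replace (6 / 5) with (1 + 1 / 5) by field.
      eapply Rle_trans; [|apply Rle_pow_lin; lra]. lra. }
    assert (Hk2 : (INR k / 5) ^ 2 <= ((6 / 5) ^ k) ^ 2).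
    { apply pow_incr. pose proof (pos_INR k). lra. }
    nra. }
  destruct (nfloor_ex (25 * (A + 10 * M) / c + 1)) as [k [_ Hk]].
  { unfold Rdiv. pose proof (Rinv_0_lt_compat _ Hc). nra. }
  specialize (Hsq (S k)). rewrite S_INR in Hsq.
  assert (Hk' : 25 * (A + 10 * M) < (INR k + 1) * c).
  { replace (25 * (A + 10 * M)) with (25 * (A + 10 * M) / c * c) by (field; lra).
    apply Rmult_lt_compat_r; lra. }
  pose proof (pos_INR k). nra.
Qed.

(** * Complex-valued functions of a real variable *)

Definition cC (f : R -> C) : Prop :=
  forall x : R, continuous (fun t => Re (f t)) x /\ continuous (fun t => Im (f t)) x.

Definition dC (f : R -> C) (x : R) (l : C) : Prop :=
  is_derive (fun t => Re (f t)) x (Re l) /\ is_derive (fun t => Im (f t)) x (Im l).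

Lemma cC_const (c : C) : cC (fun _ => c).
Proof. intro x. split; apply continuous_const. Qed.

Lemma cC_RtoC (g : R -> R) : (forall x, continuous g x) -> cC (fun t => RtoC (g t)).
Proof. intros H x. split; [apply H | apply continuous_const]. Qed.

Lemma cC_plus (f g : R -> C) : cC f -> cC g -> cC (fun t => f t + g t)%C.
Proof.
  intros Hf Hg x. destruct (Hf x), (Hg x).
  split; cbn; apply (continuous_plus (V := R_NormedModule)); assumption.
Qed.

Lemma cC_mult (f g : R -> C) : cC f -> cC g -> cC (fun t => f t * g t)%C.
Proof.
  intros Hf Hg x. destruct (Hf x), (Hg x). split; cbn.
  - apply (continuous_minus (V := R_NormedModule)); apply (continuous_mult (K := R_AbsRing)); assumption.
  - apply (continuous_plus (V := R_NormedModule)); apply (continuous_mult (K := R_AbsRing)); assumption.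
Qed.

Lemma cC_ext (f g : R -> C) : (forall x, f x = g x) -> cC f -> cC g.
Proof.
  intros E Hf x. destruct (Hf x) as [H1 H2].
  split; [eapply continuous_ext; [|exact H1] | eapply continuous_ext; [|exact H2]];
    intro t; simpl; rewrite E; reflexivity.
Qed.

Lemma dC_eq (f : R -> C) (x : R) (l l' : C) : l = l' -> dC f x l -> dC f x l'.
Proof. intros <-; auto. Qed.

Lemma dC_unique (f : R -> C) (x : R) (l l' : C) : dC f x l -> dC f x l' -> l = l'.
Proof.
  intros [H1 H2] [H3 H4].
  apply is_derive_unique in H1, H2, H3, H4.
  destruct l, l'. cbn in *. congruence.
Qed.

Lemma dC_ext_loc (f g : R -> C) (x : R) (l : C) :
  locally x (fun t => f t = g t) -> dC f x l -> dC g x l.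
Proof.
  intros E [H1 H2]. split; [eapply is_derive_ext_loc; [|exact H1] | eapply is_derive_ext_loc; [|exact H2]];
    (eapply filter_imp; [|exact E]); intros t Et; simpl; rewrite Et; reflexivity.
Qed.

Lemma dC_const (c : C) (x : R) : dC (fun _ => c) x 0.
Proof. split; apply (is_derive_const (V := R_NormedModule)). Qed.

Lemma dC_RtoC (g : R -> R) (x l : R) : is_derive g x l -> dC (fun t => RtoC (g t)) x (RtoC l).
Proof. intro H. split; [exact H | exact (is_derive_const (V := R_NormedModule) 0 x)]. Qed.

Lemma dC_plus (f g : R -> C) (x : R) (a b : C) :
  dC f x a -> dC g x b -> dC (fun t => f t + g t)%C x (a + b)%C.
Proof.
  intros [H1 H2] [H3 H4].
  split; cbn; apply (is_derive_plus (V := R_NormedModule)); assumption.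
Qed.

Lemma dC_mult (f g : R -> C) (x : R) (a b : C) :
  dC f x a -> dC g x b -> dC (fun t => f t * g t)%C x (a * g x + f x * b)%C.
Proof.
  assert (Hm : forall (u v : R -> R) (a b : R), is_derive u x a -> is_derive v x b ->
    is_derive (fun t => u t * v t) x (a * v x + u x * b)).
  { intros u v a' b' Hu Hv. apply (is_derive_mult (K := R_AbsRing) u v x a' b' Hu Hv).
    intros; apply Rmult_comm. }
  intros [H1 H2] [H3 H4]. split.
  - change (Re (a * g x + f x * b)%C)
      with ((Re a * Re (g x) - Im a * Im (g x)) + (Re (f x) * Re b - Im (f x) * Im b)).
    evar_last.
    + apply (is_derive_minus (V := R_NormedModule)).
      * apply (Hm _ _ _ _ H1 H3).
      * apply (Hm _ _ _ _ H2 H4).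
    + unfold minus, plus, opp; cbn; unfold Re, Im; ring.
  - change (Im (a * g x + f x * b)%C)
      with ((Re a * Im (g x) + Im a * Re (g x)) + (Re (f x) * Im b + Im (f x) * Re b)).
    evar_last.
    + apply (is_derive_plus (V := R_NormedModule)).
      * apply (Hm _ _ _ _ H1 H4).
      * apply (Hm _ _ _ _ H2 H3).
    + unfold minus, plus, opp; cbn; unfold Re, Im; ring.
Qed.

Lemma ex_RInt_of_continuous (g : R -> R) (a b : R) : (forall x, continuous g x) -> ex_RInt g a b.
Proof. intro H. apply (ex_RInt_continuous (V := R_CompleteNormedModule)). auto. Qed.

Lemma RInt_open_FTC (F G : R -> R) :
  (forall x, continuous F x) -> (forall x, continuous G x) ->
  (forall x, 0 < x < 1 -> is_derive F x (G x)) ->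
  RInt G 0 1 = F 1 - F 0.
Proof.
  intros HF HG Hd.
  assert (HI : forall x, is_derive (RInt G 0) x (G x)).
  { intro x. apply (is_derive_RInt (V := R_NormedModule) G (RInt G 0) 0 x); [|apply HG].
    apply filter_forall. intro y. apply (RInt_correct (V := R_CompleteNormedModule)), ex_RInt_of_continuous, HG. }
  destruct (MVT_gen (fun x => F x - RInt G 0 x) 0 1 (fun _ => 0)) as [c [_ Hc]].
  - rewrite Rmin_left, Rmax_right by lra. intros x Hx.
    evar_last; [apply (is_derive_minus (V := R_NormedModule)); [apply (Hd x Hx) | apply HI]|].
    unfold minus, plus, opp; simpl; ring.
  - intros x _. apply continuity_pt_filterlim.
    apply (continuous_minus (V := R_NormedModule)); [apply HF|].
    apply (ex_derive_continuous (V := R_NormedModule)). eexists; apply HI.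
  - rewrite (RInt_point (V := R_CompleteNormedModule)) in Hc. unfold zero in Hc; simpl in Hc. lra.
Qed.

Definition CInt (f : R -> C) : C :=
  (RInt (fun t => Re (f t)) 0 1, RInt (fun t => Im (f t)) 0 1).

Lemma CInt_ext (f g : R -> C) : (forall x, 0 < x < 1 -> f x = g x) -> CInt f = CInt g.
Proof.
  intro E. unfold CInt. f_equal; apply RInt_ext; intros x Hx;
    rewrite Rmin_left, Rmax_right in Hx by lra; rewrite (E x Hx); reflexivity.
Qed.

Lemma CInt_plus (f g : R -> C) : cC f -> cC g -> CInt (fun t => f t + g t)%C = (CInt f + CInt g)%C.
Proof.
  intros Hf Hg. apply injective_projections.
  - apply (RInt_plus (V := R_CompleteNormedModule) (fun t => Re (f t)) (fun t => Re (g t)));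
      apply ex_RInt_of_continuous; intro x; [exact (proj1 (Hf x)) | exact (proj1 (Hg x))].
  - apply (RInt_plus (V := R_CompleteNormedModule) (fun t => Im (f t)) (fun t => Im (g t)));
      apply ex_RInt_of_continuous; intro x; [exact (proj2 (Hf x)) | exact (proj2 (Hg x))].
Qed.

Lemma CInt_scal (c : C) (f : R -> C) : cC f -> CInt (fun t => c * f t)%C = (c * CInt f)%C.
Proof.
  intros Hf.
  assert (E1 : ex_RInt (fun t => Re (f t)) 0 1) by (apply ex_RInt_of_continuous; intro x; exact (proj1 (Hf x))).
  assert (E2 : ex_RInt (fun t => Im (f t)) 0 1) by (apply ex_RInt_of_continuous; intro x; exact (proj2 (Hf x))).
  destruct c as [a b]. unfold CInt. apply injective_projections; cbn.
  - transitivity (RInt (fun t => minus (scal a (Re (f t))) (scal b (Im (f t)))) 0 1); [reflexivity|].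
    rewrite (RInt_minus (V := R_CompleteNormedModule)), !(RInt_scal (V := R_CompleteNormedModule));
      try assumption; try (apply (ex_RInt_scal (V := R_NormedModule)); assumption). reflexivity.
  - transitivity (RInt (fun t => plus (scal a (Im (f t))) (scal b (Re (f t)))) 0 1); [reflexivity|].
    rewrite (RInt_plus (V := R_CompleteNormedModule)), !(RInt_scal (V := R_CompleteNormedModule));
      try assumption; try (apply (ex_RInt_scal (V := R_NormedModule)); assumption). reflexivity.
Qed.

Lemma CInt_open_FTC (F G : R -> C) :
  cC F -> cC G -> (forall x, 0 < x < 1 -> dC F x (G x)) -> CInt G = (F 1 - F 0)%C.
Proof.
  intros HF HG Hd. apply injective_projections.
  - exact (RInt_open_FTC (fun t => Re (F t)) (fun t => Re (G t)) (fun x => proj1 (HF x))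
             (fun x => proj1 (HG x)) (fun x Hx => proj1 (Hd x Hx))).
  - exact (RInt_open_FTC (fun t => Im (F t)) (fun t => Im (G t)) (fun x => proj2 (HF x))
             (fun x => proj2 (HG x)) (fun x Hx => proj2 (Hd x Hx))).
Qed.

Lemma Cmod_CInt_le (f : R -> C) (M : R) :
  cC f -> (forall x, 0 <= x <= 1 -> Cmod (f x) <= M) -> Cmod (CInt f) <= 2 * M.
Proof.
  intros Hf HM.
  assert (Hb : forall p : C -> R, (forall z, Rabs (p z) <= Cmod z) ->
    (forall x, continuous (fun t => p (f t)) x) -> Rabs (RInt (fun t => p (f t)) 0 1) <= M).
  { intros p Hp Hc. replace M with ((1 - 0) * M) by ring.
    apply abs_RInt_le_const; [lra | apply ex_RInt_of_continuous, Hc |].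
    intros t Ht. eapply Rle_trans; [apply Hp | apply HM; exact Ht]. }
  assert (Him : forall z, Rabs (Im z) <= Cmod z).
  { intro z. eapply Rle_trans; [apply Rmax_r | apply Rmax_Cmod]. }
  assert (H1 := Hb Re re_le_Cmod (fun x => proj1 (Hf x))).
  assert (H2 := Hb Im Him (fun x => proj2 (Hf x))).
  assert (HM0 : 0 <= M) by (eapply Rle_trans; [apply Rabs_pos | exact H1]).
  apply Rsqr_incr_0_var; [|lra]. rewrite !Rsqr_pow2, Cmod2_alt.
  unfold CInt at 1 2. cbn [Re Im fst snd].
  rewrite <- (pow2_abs (RInt _ _ _)), <- (pow2_abs (RInt (fun t => Im (f t)) 0 1)).
  assert (forall a, 0 <= a -> a <= M -> a ^ 2 <= M ^ 2) by (intros; apply pow_incr; lra).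
  assert (A1 := H _ (Rabs_pos _) H1). assert (A2 := H _ (Rabs_pos _) H2). nra.
Qed.

Definition cexp (z : C) : C := (exp (Re z) * cos (Im z), exp (Re z) * sin (Im z)).

Lemma cexp_plus (a b : C) : cexp (a + b) = (cexp a * cexp b)%C.
Proof.
  unfold cexp. rewrite re_plus, im_plus, exp_plus, cos_plus, sin_plus.
  apply injective_projections; cbn -[Re Im]; ring.
Qed.

Lemma cexp_RtoC (x : R) : cexp (RtoC x) = RtoC (exp x).
Proof.
  unfold cexp. rewrite re_RtoC, im_RtoC, cos_0, sin_0.
  apply injective_projections; cbn; ring.
Qed.

Lemma Cmod_cexp (z : C) : Cmod (cexp z) = exp (Re z).
Proof.
  apply Rsqr_inj; [apply Cmod_ge_0 | left; apply exp_pos |].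
  destruct z as [a b]. rewrite !Rsqr_pow2, Cmod2_alt. unfold cexp, Re, Im. cbn [fst snd].
  pose proof (sin2_cos2 b) as H. rewrite !Rsqr_pow2 in H.
  replace ((exp a * cos b) ^ 2 + (exp a * sin b) ^ 2)
    with (exp a ^ 2 * (sin b ^ 2 + cos b ^ 2)) by ring.
  rewrite H. ring.
Qed.

Lemma cexp_neq0 (z : C) : cexp z <> 0.
Proof. apply Cmod_gt_0. rewrite Cmod_cexp. apply exp_pos. Qed.

Lemma cC_cexp (f : R -> C) : cC f -> cC (fun t => cexp (f t)).
Proof.
  intros Hf x. destruct (Hf x) as [H1 H2].
  assert (He : continuous (fun t => exp (Re (f t))) x).
  { apply (continuous_comp (fun t => Re (f t)) exp); [exact H1|].
    apply continuity_pt_filterlim, derivable_continuous_pt, derivable_pt_exp. }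
  split.
  - apply (continuous_mult (K := R_AbsRing)); [exact He|].
    apply (continuous_comp (fun t => Im (f t)) cos); [exact H2|].
    apply continuity_pt_filterlim, continuity_cos.
  - apply (continuous_mult (K := R_AbsRing)); [exact He|].
    apply (continuous_comp (fun t => Im (f t)) sin); [exact H2|].
    apply continuity_pt_filterlim, continuity_sin.
Qed.

Lemma dC_cexp (f : R -> C) (x : R) (l : C) :
  dC f x l -> dC (fun t => cexp (f t)) x (l * cexp (f x))%C.
Proof.
  intros [H1 H2].
  assert (Hreal : forall (u v : R -> R) (a b : R), is_derive u x a -> is_derive v x b ->
    is_derive (fun t => exp (u t) * cos (v t)) x
      (a * (exp (u x) * cos (v x)) - b * (exp (u x) * sin (v x))) /\
    is_derive (fun t => exp (u t) * sin (v t)) x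
      (a * (exp (u x) * sin (v x)) + b * (exp (u x) * cos (v x)))).
  { intros u v a b Hu Hv.
    assert (X1 : Derive (fun t => u t) x = a) by exact (is_derive_unique _ _ _ Hu).
    assert (X2 : Derive (fun t => v t) x = b) by exact (is_derive_unique _ _ _ Hv).
    split; (auto_derive; [repeat split; eexists; eassumption|]); rewrite X1, X2; ring. }
  destruct (Hreal _ _ _ _ H1 H2) as [H3 H4]. split.
  - exact H3.
  - replace (Im (l * cexp (f x))) with
      (Re l * (exp (Re (f x)) * sin (Im (f x))) + Im l * (exp (Re (f x)) * cos (Im (f x))))
      by reflexivity.
    exact H4.
Qed.

(* [|t|] in place of [t] makes the function continuous on the whole line. *)
Definition log_weight (a b : C) (t : R) : C :=
  cexp (a * RtoC (ln (1 + Rabs t)) + b * RtoC (ln (1 + t ^ 2)))%C.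

Lemma continuous_ln_comp (g : R -> R) (x : R) :
  0 < g x -> continuous g x -> continuous (fun t => ln (g t)) x.
Proof.
  intros Hp Hg. apply (continuous_comp g ln); [exact Hg|].
  apply (ex_derive_continuous (V := R_NormedModule)). eexists. apply is_derive_ln, Hp.
Qed.

Lemma cC_log_weight (a b : C) : cC (log_weight a b).
Proof.
  apply cC_cexp, cC_plus; (apply cC_mult; [apply cC_const | apply cC_RtoC; intro x]).
  - apply continuous_ln_comp; [pose proof (Rabs_pos x); lra|].
    apply (continuous_plus (V := R_NormedModule)); [apply continuous_const | apply continuous_Rabs].
  - apply continuous_ln_comp; [nra|].
    apply (ex_derive_continuous (V := R_NormedModule)). auto_derive; exact I.
Qed.

Lemma log_weight_plus (a b a' b' : C) (t : R) :
  log_weight (a + a') (b + b') t = (log_weight a b t * log_weight a' b' t)%C.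
Proof. unfold log_weight. rewrite <- cexp_plus. f_equal. ring. Qed.

Lemma log_weight_1_0 (t : R) : log_weight 1 0 t = RtoC (1 + Rabs t).
Proof.
  unfold log_weight. rewrite <- (exp_ln (1 + Rabs t)) by (pose proof (Rabs_pos t); lra).
  rewrite <- cexp_RtoC. f_equal. rewrite exp_ln by (pose proof (Rabs_pos t); lra). ring.
Qed.

Lemma log_weight_0_1 (t : R) : log_weight 0 1 t = RtoC (1 + t ^ 2).
Proof.
  unfold log_weight. rewrite <- (exp_ln (1 + t ^ 2)) by nra.
  rewrite <- cexp_RtoC. f_equal. rewrite exp_ln by nra. ring.
Qed.

Lemma log_weight_pred_l (a b : C) (t : R) :
  (log_weight (a - 1) b t * RtoC (1 + Rabs t) = log_weight a b t)%C.
Proof.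
  rewrite <- log_weight_1_0, <- log_weight_plus. f_equal; ring.
Qed.

Lemma log_weight_pred_r (a b : C) (t : R) :
  (log_weight a (b - 1) t * RtoC (1 + t ^ 2) = log_weight a b t)%C.
Proof.
  rewrite <- log_weight_0_1, <- log_weight_plus. f_equal; ring.
Qed.

Lemma RtoC_neq0 (r : R) : r <> 0 -> RtoC r <> 0.
Proof. intros H E. apply H, RtoC_inj, E. Qed.

Lemma dC_log_weight (a b : C) (x : R) : 0 < x ->
  dC (log_weight a b) x
    ((a / RtoC (1 + x) + b * 2 * RtoC x / RtoC (1 + x ^ 2)) * log_weight a b x)%C.
Proof.
  intro Hx.
  assert (D1 : is_derive (fun t => ln (1 + Rabs t)) x (/ (1 + x))).
  { apply is_derive_ext_loc with (fun t => ln (1 + t)).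
    - exists (mkposreal x Hx). intros y Hy. rewrite Rabs_pos_eq; [reflexivity|].
      apply Rabs_def2 in Hy. unfold minus, plus, opp in Hy; simpl in Hy. lra.
    - auto_derive; [lra | field; lra]. }
  assert (D2 : is_derive (fun t => ln (1 + t ^ 2)) x (2 * x / (1 + x ^ 2))).
  { auto_derive; [nra | field; nra]. }
  eapply dC_eq; [|exact (dC_cexp _ _ _ (dC_plus _ _ _ _ _
    (dC_mult _ _ _ _ _ (dC_const a x) (dC_RtoC _ _ _ D1))
    (dC_mult _ _ _ _ _ (dC_const b x) (dC_RtoC _ _ _ D2))))].
  cbv beta. change (cexp (a * RtoC (ln (1 + Rabs x)) + b * RtoC (ln (1 + x ^ 2)))%C) with (log_weight a b x).
  rewrite RtoC_inv by lra. rewrite RtoC_div by nra. rewrite (RtoC_mult 2).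
  field. split; apply RtoC_neq0; nra.
Qed.

Lemma dC_log_weight_pred (a b : C) (x : R) : 0 < x ->
  dC (log_weight a b) x
    (a * log_weight (a - 1) b x + b * 2 * RtoC x * log_weight a (b - 1) x)%C.
Proof.
  intro Hx. eapply dC_eq; [|apply dC_log_weight, Hx].
  assert (E1 := log_weight_pred_l a b x). assert (E2 := log_weight_pred_r a b x).
  rewrite Rabs_pos_eq in E1 by lra.
  rewrite Cmult_plus_distr_r. rewrite <- E1 at 1. rewrite <- E2 at 1.
  field. split; apply RtoC_neq0; nra.
Qed.

Definition end_weight (l : C) (t : R) : C :=
  if Rlt_dec t 1 then cexp ((l + 1) * RtoC (ln (1 - t)))%C else 0.

Lemma locally_lt (x : R) : x < 1 -> locally x (fun t => t < 1).
Proof. intro H. apply (open_lt 1 x H). Qed.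

Lemma dC_end_weight (l : C) (x : R) : x < 1 ->
  dC (end_weight l) x (- (l + 1) / RtoC (1 - x) * end_weight l x)%C.
Proof.
  intro Hx. apply dC_ext_loc with (fun t => cexp ((l + 1) * RtoC (ln (1 - t)))%C).
  { eapply filter_imp; [|apply locally_lt, Hx]. intros t Ht. unfold end_weight.
    destruct (Rlt_dec t 1); [reflexivity | contradiction]. }
  assert (D1 : is_derive (fun t => ln (1 - t)) x (- / (1 - x))).
  { auto_derive; [lra | field; lra]. }
  eapply dC_eq; [|exact (dC_cexp _ _ _
    (dC_mult _ _ _ _ _ (dC_const (l + 1)%C x) (dC_RtoC _ _ _ D1)))].
  unfold end_weight. destruct (Rlt_dec x 1); [|contradiction].
  rewrite RtoC_opp, RtoC_inv by lra. field. intro E. apply RtoC_inj in E; lra.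
Qed.

Lemma Cmod_end_weight (l : C) (t : R) : 0 <= Re l -> 0 <= t -> Cmod (end_weight l t) <= Rabs (1 - t).
Proof.
  intros Hl Ht. unfold end_weight. destruct (Rlt_dec t 1) as [H|H].
  - rewrite Cmod_cexp, re_scal_r, re_plus, re_RtoC.
    rewrite Rabs_pos_eq by lra. rewrite <- (exp_ln (1 - t)) at 2 by lra.
    assert (ln (1 - t) <= 0).
    { rewrite <- ln_1. destruct (Req_dec t 0) as [->|]; [rewrite Rminus_0_r; lra|].
      left; apply ln_increasing; lra. }
    destruct (Req_dec ((Re l + 1) * ln (1 - t)) (ln (1 - t))) as [->|]; [lra|].
    left. apply exp_increasing. nra.
  - rewrite Cmod_0. apply Rabs_pos.
Qed.

Lemma continuous_of_le (g : R -> R) (x : R) :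
  g x = 0 -> locally x (fun t => Rabs (g t) <= Rabs (x - t)) -> continuous g x.
Proof.
  intros Hx Hb. apply continuity_pt_filterlim. intros eps Heps.
  destruct Hb as [d Hd]. exists (Rmin eps d). split; [apply Rmin_pos; [exact Heps | apply cond_pos]|].
  intros t [_ Ht]. cbn in *. unfold R_dist in *. rewrite Hx, Rminus_0_r.
  eapply Rle_lt_trans; [apply Hd|].
  - unfold ball; cbn. unfold AbsRing_ball, abs, minus, plus, opp; cbn.
    eapply Rlt_le_trans; [exact Ht | apply Rmin_r].
  - rewrite Rabs_minus_sym. eapply Rlt_le_trans; [exact Ht | apply Rmin_l].
Qed.

Lemma cC_end_weight (l : C) : 0 <= Re l -> cC (end_weight l).
Proof.
  intros Hl x. destruct (Rtotal_order x 1) as [H|[->|H]].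
  - destruct (dC_end_weight l x H) as [H1 H2].
    split; apply (ex_derive_continuous (V := R_NormedModule)); eexists; eassumption.
  - assert (E : end_weight l 1 = 0).
    { unfold end_weight. destruct (Rlt_dec 1 1); [lra | reflexivity]. }
    assert (HL : locally 1 (fun t => Cmod (end_weight l t) <= Rabs (1 - t))).
    { eapply filter_imp; [|apply (open_gt 0 1 Rlt_0_1)]. intros t Ht.
      apply Cmod_end_weight; [exact Hl | lra]. }
    split; apply continuous_of_le; try (rewrite E; reflexivity);
      (eapply filter_imp; [|exact HL]); intros t Ht; (eapply Rle_trans; [|exact Ht]).
    + apply re_le_Cmod.
    + eapply Rle_trans; [apply Rmax_r | apply Rmax_Cmod].
  - assert (HL : locally x (fun t => RtoC 0 = end_weight l t)).
    { eapply filter_imp; [|apply (open_gt 1 x H)]. intros t Ht.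
      unfold end_weight. destruct (Rlt_dec t 1); [lra | reflexivity]. }
    split; (eapply continuous_ext_loc; [eapply filter_imp; [|exact HL]; intros t Ht; simpl; rewrite <- Ht; reflexivity|]);
      apply continuous_const.
Qed.

Lemma end_weight_neq0 (l : C) (t : R) : t < 1 -> end_weight l t <> 0.
Proof.
  intro H. unfold end_weight. destruct (Rlt_dec t 1); [apply cexp_neq0 | contradiction].
Qed.

(** * Regularised pairing with the adjoint weight *)

Lemma cC_id : cC (fun t => RtoC t).
Proof. apply cC_RtoC. intro x. apply continuous_id. Qed.

Ltac solve_cC :=
  repeat match goal with
  | |- cC (fun t => Cplus (@?f t) (@?g t)) => apply (cC_plus f g)
  | |- cC (fun t => Cmult (@?f t) (@?g t)) => apply (cC_mult f g)
  | |- cC (fun t => log_weight ?a ?b t) => exact (cC_log_weight a b)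
  | |- cC (fun t => RtoC t) => exact cC_id
  | |- cC (fun _ => ?c) => exact (cC_const c)
  | |- cC _ => assumption
  end.

Definition jet (u u1 u2 : R -> C) : Prop :=
  cC u /\ cC u1 /\ cC u2 /\
  forall x, 0 < x < 1 -> dC u x (u1 x) /\ dC u1 x (u2 x).

Lemma jet_const (c : C) : jet (fun _ => c) (fun _ => 0) (fun _ => 0).
Proof.
  split; [|split; [|split]]; [exact (cC_const c) | exact (cC_const 0) | exact (cC_const 0) |].
  intros x _. split; [exact (dC_const c x) | exact (dC_const 0 x)].
Qed.

Lemma jet_RtoC (g g1 g2 : R -> R) :
  (forall x, is_derive g x (g1 x)) -> (forall x, is_derive g1 x (g2 x)) ->
  (forall x, continuous g2 x) ->
  jet (fun t => RtoC (g t)) (fun t => RtoC (g1 t)) (fun t => RtoC (g2 t)).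
Proof.
  intros H1 H2 H3. split; [|split; [|split]].
  - apply cC_RtoC. intro x. apply (ex_derive_continuous (V := R_NormedModule)). eexists; apply H1.
  - apply cC_RtoC. intro x. apply (ex_derive_continuous (V := R_NormedModule)). eexists; apply H2.
  - apply cC_RtoC, H3.
  - intros x _. split; apply dC_RtoC; [apply H1 | apply H2].
Qed.

Lemma jet_plus (u u1 u2 v v1 v2 : R -> C) : jet u u1 u2 -> jet v v1 v2 ->
  jet (fun t => u t + v t)%C (fun t => u1 t + v1 t)%C (fun t => u2 t + v2 t)%C.
Proof.
  intros (A1 & A2 & A3 & A4) (B1 & B2 & B3 & B4).
  split; [|split; [|split]]; try (apply cC_plus; assumption).
  intros x Hx. destruct (A4 x Hx), (B4 x Hx). split; apply dC_plus; assumption.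
Qed.

Lemma jet_mult (u u1 u2 v v1 v2 : R -> C) : jet u u1 u2 -> jet v v1 v2 ->
  jet (fun t => u t * v t)%C (fun t => u1 t * v t + u t * v1 t)%C
      (fun t => (u2 t * v t + u1 t * v1 t) + (u1 t * v1 t + u t * v2 t))%C.
Proof.
  intros (A1 & A2 & A3 & A4) (B1 & B2 & B3 & B4).
  split; [|split; [|split]].
  - apply cC_mult; assumption.
  - apply cC_plus; apply cC_mult; assumption.
  - apply cC_plus; apply cC_plus; apply cC_mult; assumption.
  - intros x Hx. destruct (A4 x Hx), (B4 x Hx).
    split; [apply dC_mult | apply dC_plus; apply dC_mult]; assumption.
Qed.

Definition C2 (u : R -> C) : Prop := exists u1 u2, jet u u1 u2.

Lemma C2_const (c : C) : C2 (fun _ => c).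
Proof. do 2 eexists. apply jet_const. Qed.

Lemma C2_id : C2 (fun t => RtoC t).
Proof.
  do 2 eexists. apply (jet_RtoC (fun t => t) (fun _ => 1) (fun _ => 0)); intro x.
  - apply (is_derive_id (K := R_AbsRing)).
  - apply (is_derive_const (V := R_NormedModule)).
  - apply continuous_const.
Qed.

Lemma C2_plus (u v : R -> C) : C2 u -> C2 v -> C2 (fun t => u t + v t)%C.
Proof. intros (u1 & u2 & Hu) (v1 & v2 & Hv). do 2 eexists. apply jet_plus; eassumption. Qed.

Lemma C2_mult (u v : R -> C) : C2 u -> C2 v -> C2 (fun t => u t * v t)%C.
Proof. intros (u1 & u2 & Hu) (v1 & v2 & Hv). do 2 eexists. apply jet_mult; eassumption. Qed.

Lemma C2_ext (u v : R -> C) : (forall t, u t = v t) -> C2 u -> C2 v.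
Proof.
  intros E (u1 & u2 & A1 & A2 & A3 & A4). exists u1, u2. split; [|split; [|split]]; try assumption.
  - eapply cC_ext; [exact E | exact A1].
  - intros x Hx. destruct (A4 x Hx). split; [|assumption].
    eapply dC_ext_loc; [|eassumption]. apply filter_forall. exact E.
Qed.

Lemma C2_log_weight (a b : C) : C2 (log_weight a b).
Proof.
  exists (fun t => a * log_weight (a - 1) b t + b * 2 * RtoC t * log_weight a (b - 1) t)%C.
  exists (fun t => (0 * log_weight (a - 1) b t
      + a * ((a - 1) * log_weight (a - 1 - 1) b t
             + b * 2 * RtoC t * log_weight (a - 1) (b - 1) t))
    + ((0 * RtoC t + b * 2 * RtoC 1) * log_weight a (b - 1) t
       + b * 2 * RtoC t * (a * log_weight (a - 1) (b - 1) t
             + (b - 1) * 2 * RtoC t * log_weight a (b - 1 - 1) t)))%C.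
  split; [|split; [|split]].
  - apply cC_log_weight.
  - solve_cC.
  - solve_cC.
  - intros x [Hx _]. split; [apply dC_log_weight_pred, Hx|].
    apply dC_plus; (apply dC_mult; [|apply dC_log_weight_pred, Hx]).
    + exact (dC_const a x).
    + apply (dC_mult (fun _ => (b * 2)%C) (fun t => RtoC t)); [exact (dC_const (b * 2) x)|].
      apply dC_RtoC. apply (is_derive_id (K := R_AbsRing)).
Qed.

Lemma jet_flat_mult (m m1 m2 k : R -> C) :
  jet m m1 m2 -> m 0 = 0 -> m1 0 = 0 -> C2 k ->
  exists u1 u2, jet (fun t => m t * k t)%C u1 u2 /\ u1 0 = 0.
Proof.
  intros Hm H0 H1 (k1 & k2 & Hk). do 2 eexists. split; [apply jet_mult; eassumption|].
  cbv beta. rewrite H0, H1. ring.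
Qed.

(* The Hadamard finite part of [int_0^1 (1-t)^(l-1) h dt], multiplied by [l (l + 1)]. *)
Definition pairing (l : C) (h : R -> C) : C :=
  CInt (fun t => end_weight l t * Derive_RC (Derive_RC h) t)%C.

Lemma Derive_RC_eq (f : R -> C) (x : R) (l : C) : dC f x l -> Derive_RC f x = l.
Proof.
  intros [H1 H2]. apply injective_projections; cbn [Derive_RC fst snd].
  - exact (is_derive_unique _ _ _ H1).
  - exact (is_derive_unique _ _ _ H2).
Qed.

Lemma locally_open_unit (x : R) : 0 < x < 1 -> locally x (fun t => 0 < t < 1).
Proof.
  intros [H1 H2]. apply filter_and; [apply (open_gt 0 x H1) | apply (open_lt 1 x H2)].
Qed.

Lemma Derive_RC_jet (u u1 u2 : R -> C) (x : R) :
  jet u u1 u2 -> 0 < x < 1 -> Derive_RC u x = u1 x /\ Derive_RC (Derive_RC u) x = u2 x.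
Proof.
  intros (_ & _ & _ & H) Hx. split; apply Derive_RC_eq; [apply H, Hx|].
  eapply dC_ext_loc; [|apply H, Hx].
  eapply filter_imp; [|apply locally_open_unit, Hx].
  intros t Ht. symmetry. apply Derive_RC_eq, H, Ht.
Qed.

Lemma pairing_jet (l : C) (u u1 u2 : R -> C) :
  jet u u1 u2 -> pairing l u = CInt (fun t => end_weight l t * u2 t)%C.
Proof.
  intro H. apply CInt_ext. intros x Hx. destruct (Derive_RC_jet u u1 u2 x H Hx) as [_ ->]. reflexivity.
Qed.

Lemma pairing_lin (l a b : C) (u v : R -> C) : 0 <= Re l -> C2 u -> C2 v ->
  pairing l (fun t => a * u t + b * v t)%C = (a * pairing l u + b * pairing l v)%C.
Proof.
  intros Hl (u1 & u2 & Hu) (v1 & v2 & Hv).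
  rewrite (pairing_jet l _ _ _ (jet_plus _ _ _ _ _ _
    (jet_mult _ _ _ _ _ _ (jet_const a) Hu) (jet_mult _ _ _ _ _ _ (jet_const b) Hv))).
  rewrite (pairing_jet l _ _ _ Hu), (pairing_jet l _ _ _ Hv).
  destruct Hu as (_ & _ & Hu & _). destruct Hv as (_ & _ & Hv & _).
  assert (Hp := cC_end_weight l Hl).
  rewrite <- !CInt_scal by solve_cC.
  rewrite <- CInt_plus by solve_cC.
  apply CInt_ext. intros. ring.
Qed.

Lemma end_weight_1 (l : C) : end_weight l 1 = 0.
Proof. unfold end_weight. destruct (Rlt_dec 1 1); [lra | reflexivity]. Qed.

Lemma pairing_exact (l : C) (h h1 h2 B B1 B2 : R -> C) :
  0 <= Re l -> jet h h1 h2 -> jet B B1 B2 -> h1 0 = 0 -> B1 0 = 0 ->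
  (forall x, 0 < x < 1 -> h x = (- l * B x + RtoC (1 - x) * B1 x)%C) ->
  pairing l h = 0.
Proof.
  intros Hl Hh HB Hh0 HB0 E. rewrite (pairing_jet l _ _ _ Hh).
  destruct Hh as (_ & Ch1 & Ch2 & Dh). destruct HB as (_ & CB1 & CB2 & DB).
  assert (Hp := cC_end_weight l Hl).
  rewrite (CInt_open_FTC (fun t => end_weight l t * (h1 t + (l + 1) * B1 t))%C).
  - rewrite end_weight_1, Hh0, HB0. ring.
  - solve_cC.
  - solve_cC.
  - intros x Hx. destruct (Dh x Hx) as [Dh0 Dh1]. destruct (DB x Hx) as [DB0 DB1].
    assert (E1 : h1 x = (- l * B1 x + (RtoC (-1) * B1 x + RtoC (1 - x) * B2 x))%C).
    { apply (dC_unique h x _ _ Dh0).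
      apply dC_ext_loc with (fun t => - l * B t + RtoC (1 - t) * B1 t)%C.
      { eapply filter_imp; [|apply locally_open_unit, Hx]. intros t Ht. symmetry. apply E, Ht. }
      apply dC_plus.
      - eapply dC_eq; [|apply (dC_mult (fun _ => - l)%C B); [exact (dC_const (- l) x) | exact DB0]]. ring.
      - apply (dC_mult (fun t => RtoC (1 - t)) B1); [|exact DB1].
        apply dC_RtoC. auto_derive; [exact I | ring]. }
    eapply dC_eq; [|apply dC_mult; [apply dC_end_weight; lra |
      apply dC_plus; [exact Dh1 | apply (dC_mult (fun _ => l + 1)%C); [exact (dC_const (l + 1) x) | exact DB1]]]].
    cbv beta. rewrite E1. field. intro F. apply RtoC_inj in F. lra.
Qed.

Lemma pairing_double (l : C) (h h1 h2 k k1 k2 : R -> C) :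
  0 <= Re l -> jet h h1 h2 -> jet k k1 k2 -> h1 0 = 0 -> k 0 = 0 ->
  (forall x, 0 < x < 1 -> h x = (RtoC ((1 - x) ^ 2) * k x)%C) ->
  pairing l h = (l * (l + 1) * CInt (fun t => end_weight l t * k t))%C.
Proof.
  intros Hl Hh Hk Hh0 Hk0 E. rewrite (pairing_jet l _ _ _ Hh).
  destruct Hh as (_ & Ch1 & Ch2 & Dh). destruct Hk as (Ck & Ck1 & _ & Dk).
  assert (Hp := cC_end_weight l Hl).
  assert (Cr : cC (fun t => RtoC (1 - t))).
  { apply cC_RtoC. intro x. apply (ex_derive_continuous (V := R_NormedModule)). auto_derive; exact I. }
  assert (H0 : CInt (fun t => end_weight l t * h2 t + (- (l * (l + 1))) * (end_weight l t * k t))%C = 0).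
  { rewrite (CInt_open_FTC (fun t => end_weight l t * (h1 t + (l + 1) * (RtoC (1 - t) * k t)))%C).
    - rewrite end_weight_1, Hh0, Hk0. ring.
    - solve_cC.
    - solve_cC.
    - intros x Hx. destruct (Dh x Hx) as [Dh0 Dh1]. destruct (Dk x Hx) as [Dk0 _].
      assert (E1 : h1 x = (RtoC (-2 * (1 - x)) * k x + RtoC ((1 - x) ^ 2) * k1 x)%C).
      { apply (dC_unique h x _ _ Dh0).
        apply dC_ext_loc with (fun t => RtoC ((1 - t) ^ 2) * k t)%C.
        { eapply filter_imp; [|apply locally_open_unit, Hx]. intros t Ht. symmetry. apply E, Ht. }
        apply (dC_mult (fun t => RtoC ((1 - t) ^ 2)) k); [|exact Dk0].
        apply dC_RtoC. auto_derive; [exact I | ring]. }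
      assert (D1 : is_derive (fun t => 1 - t) x (-1)) by (auto_derive; [exact I | ring]).
      eapply dC_eq; [|apply dC_mult; [apply dC_end_weight; lra |
        apply dC_plus; [exact Dh1 | apply (dC_mult (fun _ => l + 1)%C); [exact (dC_const (l + 1) x) |
          apply (dC_mult (fun t => RtoC (1 - t)) k); [exact (dC_RtoC _ _ _ D1) | exact Dk0]]]]].
      cbv beta. rewrite E1, RtoC_mult, RtoC_pow. field. intro F. apply RtoC_inj in F. lra. }
  rewrite CInt_plus in H0 by solve_cC.
  rewrite CInt_scal in H0 by solve_cC.
  apply Ceq_minus. rewrite <- H0. ring.
Qed.

(** * Smooth solutions and their moments *)

Definition clamp (x : R) : R := Rmax 0 (Rmin 1 x).

Lemma clamp_bounds (x : R) : 0 <= clamp x <= 1.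
Proof. unfold clamp. split; [apply Rmax_l | apply Rmax_lub; [lra | apply Rmin_l]]. Qed.

Lemma clamp_id (x : R) : 0 <= x <= 1 -> clamp x = x.
Proof. intros [H1 H2]. unfold clamp. rewrite Rmin_right by exact H2. apply Rmax_right, H1. Qed.

Lemma clamp_contraction (x y : R) : Rabs (clamp y - clamp x) <= Rabs (y - x).
Proof.
  assert (H := Rle_abs (y - x)). assert (H' := Rle_abs (- (y - x))). rewrite Rabs_Ropp in H'.
  assert (H0 := Rabs_pos (y - x)).
  apply Rabs_le. unfold clamp, Rmax, Rmin.
  destruct (Rle_dec 1 x), (Rle_dec 1 y);
    repeat match goal with |- context [Rle_dec ?a ?b] => destruct (Rle_dec a b) end; lra.
Qed.

Lemma filterlim_clamp (x : R) :
  filterlim clamp (locally x) (within (fun y => 0 <= y <= 1) (locally (clamp x))).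
Proof.
  intros P [eps H]. exists eps. intros y Hy. apply H; [|apply clamp_bounds].
  eapply Rle_lt_trans; [apply clamp_contraction | exact Hy].
Qed.

Lemma cC_clamp (f : R -> C) :
  (forall x, 0 <= x <= 1 ->
     filterlim f (within (fun y => 0 <= y <= 1) (locally x)) (locally (T := C_R_NormedModule) (f x))) ->
  cC (fun t => f (clamp t)).
Proof.
  intros H x.
  assert (Hc : continuous (T := R_UniformSpace) (U := C_R_NormedModule) (fun t => f (clamp t)) x).
  { eapply filterlim_comp; [apply filterlim_clamp | apply H, clamp_bounds]. }
  split.
  - apply (continuous_comp (U := R_UniformSpace) (V := C_R_NormedModule) (fun t => f (clamp t)) fst); [exact Hc|].
    apply (continuous_fst (U := R_UniformSpace) (V := R_UniformSpace)).
  - apply (continuous_comp (U := R_UniformSpace) (V := C_R_NormedModule) (fun t => f (clamp t)) snd); [exact Hc|].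
    apply (continuous_snd (U := R_UniformSpace) (V := R_UniformSpace)).
Qed.

Lemma dC_of_within (f : R -> C) (x : R) (l : C) : 0 < x < 1 ->
  is_derive_within (fun y => 0 <= y <= 1) f x l -> dC f x l.
Proof.
  intros Hx [Hlin Hdom].
  assert (Hd : is_derive (K := R_AbsRing) (V := C_R_NormedModule) f x l).
  { split; [exact Hlin|]. intros y Hy eps.
    assert (E := is_filter_lim_locally_unique _ _ Hy). subst y.
    assert (Hw : is_filter_lim (within (fun y => 0 <= y <= 1) (locally x)) x).
    { intros P HP. apply filter_le_within, HP. }
    specialize (Hdom x Hw eps).
    assert (HI := locally_open_unit x Hx).
    generalize (filter_and _ _ HI Hdom). apply filter_imp. intros y [H1 H2]. apply H2. lra. }
  split.
  - apply (filterdiff_comp' (K := R_AbsRing) (V := C_R_NormedModule) f fst x (fun h => scal h l) fst Hd).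
    apply filterdiff_linear, is_linear_fst.
  - apply (filterdiff_comp' (K := R_AbsRing) (V := C_R_NormedModule) f snd x (fun h => scal h l) snd Hd).
    apply filterdiff_linear, is_linear_snd.
Qed.

Lemma smooth_on_unit_jets (f : R -> C) : smooth_on_Icc 0 1 f ->
  exists g0 g1 g2 g3 : R -> C,
    jet g0 g1 g2 /\ jet g1 g2 g3 /\ (forall x, 0 <= x <= 1 -> g0 x = f x).
Proof.
  intros [g [Hg0 Hg]].
  assert (Hc : forall n, cC (fun t => g n (clamp t))).
  { intro n. apply cC_clamp. intros x Hx.
    apply (filterdiff_continuous_aux (K := R_AbsRing) (U := R_NormedModule) (V := C_R_NormedModule)
             (F := within (fun y => 0 <= y <= 1) (locally x)) (g n)).
    - eexists. exact (Hg n x Hx).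
    - intros P HP. apply filter_le_within, HP. }
  assert (Hd : forall n x, 0 < x < 1 -> dC (fun t => g n (clamp t)) x (g (S n) (clamp x))).
  { intros n x Hx. rewrite clamp_id by lra.
    apply dC_ext_loc with (g n).
    - eapply filter_imp; [|apply locally_open_unit, Hx]. intros t Ht. rewrite clamp_id by lra. reflexivity.
    - apply dC_of_within; [exact Hx|]. apply Hg. lra. }
  exists (fun t => g 0%nat (clamp t)), (fun t => g 1%nat (clamp t)),
    (fun t => g 2%nat (clamp t)), (fun t => g 3%nat (clamp t)).
  split; [|split].
  - split; [|split; [|split]]; try apply Hc. intros x Hx. split; apply Hd, Hx.
  - split; [|split; [|split]]; try apply Hc. intros x Hx. split; apply Hd, Hx.
  - intros x Hx. rewrite clamp_id by exact Hx. apply Hg0, Hx.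
Qed.

Lemma cos_4_atan (x : R) :
  cos (4 * atan x) = (1 - 6 * x ^ 2 + x ^ 4) / (1 + x ^ 2) ^ 2.
Proof.
  replace (4 * atan x) with (2 * (2 * atan x)) by ring.
  rewrite cos_2a_cos, cos_2a_cos, cos_atan.
  assert (H : 0 < 1 + x ^ 2) by nra.
  assert (Hs : sqrt (1 + x²) * sqrt (1 + x²) = 1 + x ^ 2).
  { rewrite sqrt_sqrt; unfold Rsqr; nra. }
  assert (H0 : sqrt (1 + x²) <> 0) by (intro E; rewrite E in Hs; lra).
  replace (2 * (1 / sqrt (1 + x²)) * (1 / sqrt (1 + x²)))
    with (2 / (sqrt (1 + x²) * sqrt (1 + x²))) by (field; exact H0).
  rewrite Hs. field. lra.
Qed.

(* Lagrange's identity: up to the factor [(1 - x)^(1 - l)] the left-hand side is the derivative of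
   [(1 - x)^l B], where [B = m x^2 W (1 + x) Z] is the bilinear concomitant of the solution and the
   test function. *)
Lemma adjoint_identity (l nu x m W f0 f1 f2 : C) :
  (x <> 0 -> 1 + x <> 0 -> 1 - x <> 0 -> 1 + x * x <> 0 ->
  - ((1 - x * x) * f2) - 2 / x * f1 + 2 * (l + 1) * x * f1
    + 2 * ((1 - 6 * (x * x) + x ^ 4) / (1 + x * x) ^ 2) / (x * x) * f0 + l * (l + 1) * f0 = 0 ->
  let Z := x * (1 + x * x) * f1 + (- (2 * nu + 1) + l * (x * x)) * f0 in
  let Z1 := (1 + 3 * (x * x)) * f1 + x * (1 + x * x) * f2
            + (l * (2 * x) * f0 + (- (2 * nu + 1) + l * (x * x)) * f1) in
  - l * (m * (x * x) * (W * ((1 + x) * Z)))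
  + (1 - x) * (m * (2 * nu + 2) * x * (W * ((1 + x) * Z))
      + m * (x * x) * (((l - 1) / (1 + x) + (- ((l + 3) / 2) - nu) * 2 * x / (1 + x * x)) * W * ((1 + x) * Z)
                       + W * (1 * Z + (1 + x) * Z1)))
  = - (m * (x * x * x) * W * f0)
    * (4 * nu * (2 * nu + 3) * (1 + x * x) / (2 * (x * x))
       - (l * l + (8 * nu + 8) * l + (12 * (nu * nu) + 20 * nu - 9))
       + (l + 2 * nu - 1) * (l + 2 * nu + 5) * (2 * (x * x)) / (1 + x * x)))%C.
Proof.
  intros Hx H1 H2 H3 Hode Z Z1.
  assert (E : f2 = (( - (2 / x) * f1 + 2 * (l + 1) * x * f1
    + 2 * ((1 - 6 * (x * x) + x ^ 4) / (1 + x * x) ^ 2) / (x * x) * f0 + l * (l + 1) * f0)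
      / ((1 - x) * (1 + x)))%C).
  { apply Ceq_minus.
    transitivity (- (- ((1 - x * x) * f2) - 2 / x * f1 + 2 * (l + 1) * x * f1
    + 2 * ((1 - 6 * (x * x) + x ^ 4) / (1 + x * x) ^ 2) / (x * x) * f0 + l * (l + 1) * f0) / ((1 - x) * (1 + x)))%C.
    - field. auto.
    - rewrite Hode. field. auto. }
  unfold Z1, Z. rewrite E. clear Hode E Z Z1. field. repeat split; auto.
Qed.

Definition flat (u : R -> C) : Prop := exists u1 u2, jet u u1 u2 /\ u1 0 = 0.

Lemma flat_C2 (u : R -> C) : flat u -> C2 u.
Proof. intros (u1 & u2 & H & _). exists u1, u2. exact H. Qed.

Lemma flat_lin (a b : C) (u v : R -> C) : flat u -> flat v -> flat (fun t => a * u t + b * v t)%C.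
Proof.
  intros (u1 & u2 & Hu & Eu) (v1 & v2 & Hv & Ev). do 2 eexists. split.
  - exact (jet_plus _ _ _ _ _ _ (jet_mult _ _ _ _ _ _ (jet_const a) Hu)
                                (jet_mult _ _ _ _ _ _ (jet_const b) Hv)).
  - cbv beta. rewrite Eu, Ev. ring.
Qed.

Lemma is_derive_monomial (c : R) (k : nat) (x : R) :
  is_derive (fun t => c * t ^ S k) x (c * (INR (S k) * x ^ k)).
Proof. auto_derive; [exact I|]. simpl. ring. Qed.

Lemma flat_monomial_mult (c : R) (k : nat) (u : R -> C) :
  C2 u -> flat (fun t => RtoC (c * t ^ S (S k)) * u t)%C.
Proof.
  intro Hu.
  apply (jet_flat_mult _ (fun t => RtoC (c * (INR (S (S k)) * t ^ S k)))
           (fun t => RtoC (c * (INR (S (S k)) * (INR (S k) * t ^ k))))).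
  - apply jet_RtoC; intro x.
    + apply is_derive_monomial.
    + auto_derive; [exact I|]. simpl. ring.
    + apply (ex_derive_continuous (V := R_NormedModule)). auto_derive. exact I.
  - f_equal. simpl. ring.
  - f_equal. simpl. ring.
  - exact Hu.
Qed.

Definition zeta (t : R) : R := 2 * t ^ 2 / (1 + t ^ 2).

(* [zeta^n] times [g] times the adjoint weight stripped of its singular factor [(1 - t)^(l - 1)]. *)
Definition moment_fun (l : C) (g : R -> C) (n : nat) (t : R) : C :=
  (RtoC (2 ^ n * t ^ S (S (2 * n + 1)))
   * (log_weight (l - 1) (- ((l + 3) / 2) - RtoC (INR n)) t * g t))%C.

Lemma moment_fun_S (l : C) (g : R -> C) (n : nat) (t : R) :
  moment_fun l g (S n) t = (RtoC (zeta t) * moment_fun l g n t)%C.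
Proof.
  unfold moment_fun.
  rewrite <- (log_weight_pred_r (l - 1) (- ((l + 3) / 2) - RtoC (INR n)) t).
  replace (- ((l + 3) / 2) - RtoC (INR (S n)))%C with (- ((l + 3) / 2) - RtoC (INR n) - 1)%C
    by (rewrite S_INR, RtoC_plus; ring).
  replace (2 ^ S n * t ^ S (S (2 * S n + 1))) with (2 * t ^ 2 * (2 ^ n * t ^ S (S (2 * n + 1)))).
  2: { replace (2 * S n + 1)%nat with (S (S (2 * n + 1))) by lia. simpl. ring. }
  unfold zeta. rewrite RtoC_div by nra. rewrite RtoC_mult.
  field. apply RtoC_neq0. nra.
Qed.

Lemma moment_fun_pow (l : C) (g : R -> C) (n : nat) (t : R) :
  moment_fun l g n t = (RtoC (zeta t ^ n) * moment_fun l g 0 t)%C.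
Proof.
  induction n as [|n IH]; [simpl; ring|].
  rewrite moment_fun_S, IH, <- (tech_pow_Rmult (zeta t) n), RtoC_mult. ring.
Qed.

Lemma flat_moment_fun (l : C) (g : R -> C) (n : nat) : C2 g -> flat (moment_fun l g n).
Proof.
  intro Hg. apply flat_monomial_mult, C2_mult; [|exact Hg].
  exact (C2_log_weight (l - 1) (- ((l + 3) / 2) - RtoC (INR n))).
Qed.

Definition mode_ode (l : C) (g0 g1 g2 : R -> C) : Prop :=
  forall x, 0 < x < 1 ->
    (- (RtoC (1 - x ^ 2) * g2 x) - RtoC (2 / x) * g1 x
     + RtoC 2 * (l + RtoC 1) * RtoC x * g1 x
     + RtoC (2 * cos (4 * atan x) / x ^ 2) * g0 x + l * (l + RtoC 1) * g0 x)%C = 0.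

Lemma pairing_moment_vanish (l : C) (g0 g1 g2 g3 h : R -> C) (n : nat) :
  0 <= Re l -> jet g0 g1 g2 -> jet g1 g2 g3 -> mode_ode l g0 g1 g2 -> flat h ->
  let nu := RtoC (INR n) in
  (forall x, 0 < x < 1 ->
    h x = moment_fun l g0 n x
      * (4 * nu * (2 * nu + 3) * (1 + RtoC x * RtoC x) / (2 * (RtoC x * RtoC x))
         - (l * l + (8 * nu + 8) * l + (12 * (nu * nu) + 20 * nu - 9))
         + (l + 2 * nu - 1) * (l + 2 * nu + 5) * (2 * (RtoC x * RtoC x)) / (1 + RtoC x * RtoC x)))%C ->
  pairing l h = 0.
Proof.
  intros Hl J0 J1 Hode Hh nu Eh.
  set (W := log_weight (l - 1) (- ((l + 3) / 2) - nu)).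
  set (Z := fun t => (RtoC (t * (1 + t * t)) * g1 t + (- (2 * nu + 1) + l * RtoC (t * t)) * g0 t)%C).
  set (Bk := fun t => (W t * (RtoC (1 + t) * Z t))%C).
  assert (HZ : C2 Z).
  { assert (HR : forall p p1 p2 : R -> R, (forall x, is_derive p x (p1 x)) ->
      (forall x, is_derive p1 x (p2 x)) -> (forall x, continuous p2 x) -> C2 (fun t => RtoC (p t))).
    { intros p p1 p2 P1 P2 P3. exists (fun t => RtoC (p1 t)), (fun t => RtoC (p2 t)).
      apply jet_RtoC; assumption. }
    apply C2_plus; (apply C2_mult; [|eexists; eexists; eassumption]).
    - apply (HR (fun t => t * (1 + t * t)) (fun t => 1 + 3 * (t * t)) (fun t => 6 * t)); intro x;
        try (auto_derive; [exact I | ring]).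
      apply (ex_derive_continuous (V := R_NormedModule)). auto_derive. exact I.
    - apply C2_plus; [exact (C2_const (- (2 * nu + 1)))|]. apply C2_mult; [exact (C2_const l)|].
      apply (HR (fun t => t * t) (fun t => 2 * t) (fun t => 2)); intro x;
        try (auto_derive; [exact I | ring]).
      apply continuous_const. }
  assert (HBk : C2 Bk).
  { apply C2_mult; [exact (C2_log_weight _ _)|]. apply C2_mult; [|exact HZ].
    apply (C2_ext (fun t => RtoC 1 + RtoC t)%C); [intro t; rewrite RtoC_plus; reflexivity|].
    apply C2_plus; [exact (C2_const 1) | exact C2_id]. }
  destruct (flat_monomial_mult (- 2 ^ n) (2 * n) Bk HBk) as (B1 & B2 & HB & HB0).
  destruct Hh as (h1 & h2 & Hh & Hh0).
  apply (pairing_exact l h h1 h2 _ B1 B2 Hl Hh HB Hh0 HB0).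
  intros x Hx.
  assert (D0 := proj1 (proj2 (proj2 (proj2 J0)) x Hx)).
  assert (D1 := proj1 (proj2 (proj2 (proj2 J1)) x Hx)).
  assert (HC2 : RtoC (1 + x) <> 0) by (apply RtoC_neq0; lra).
  assert (HC3 : RtoC (1 - x) <> 0) by (apply RtoC_neq0; lra).
  assert (HC4 : RtoC (1 + x * x) <> 0) by (apply RtoC_neq0; nra).
  assert (HC1 : RtoC x <> 0) by (apply RtoC_neq0; lra).
  set (Z1 := ((1 + 3 * (RtoC x * RtoC x)) * g1 x + RtoC x * (1 + RtoC x * RtoC x) * g2 x
            + (l * (2 * RtoC x) * g0 x + (- (2 * nu + 1) + l * (RtoC x * RtoC x)) * g1 x))%C).
  assert (DZ : dC Z x Z1).
  { assert (P1 : is_derive (fun t => t * (1 + t * t)) x (1 + 3 * (x * x))) by (auto_derive; [exact I | ring]).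
    assert (P2 : is_derive (fun t => t * t) x (2 * x)) by (auto_derive; [exact I | ring]).
    eapply dC_eq; [|exact (dC_plus _ _ _ _ _ (dC_mult _ _ _ _ _ (dC_RtoC _ _ _ P1) D1)
      (dC_mult _ _ _ _ _ (dC_plus _ _ _ _ _ (dC_const (- (2 * nu + 1)) x)
        (dC_mult _ _ _ _ _ (dC_const l x) (dC_RtoC _ _ _ P2))) D0))].
    unfold Z1. expand_RtoC. ring. }
  assert (Dm : is_derive (fun t => - 2 ^ n * t ^ S (S (2 * n))) x
                 (- (2 ^ n * x ^ (2 * n)) * ((2 * INR n + 2) * x))).
  { evar_last; [apply is_derive_monomial|].
    rewrite !S_INR, mult_INR. simpl (INR 2). rewrite <- tech_pow_Rmult. ring. }
  assert (Dp : is_derive (fun t => 1 + t) x 1) by (auto_derive; [exact I | ring]).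
  assert (EB1 := dC_unique _ _ _ _ (proj1 (proj2 (proj2 (proj2 HB)) x Hx))
    (dC_mult _ _ _ _ _ (dC_RtoC _ _ _ Dm)
      (dC_mult _ _ _ _ _ (dC_log_weight (l - 1) (- ((l + 3) / 2) - nu) x (proj1 Hx))
        (dC_mult _ _ _ _ _ (dC_RtoC _ _ _ Dp) DZ)))).
  cbv beta in EB1. rewrite EB1, (Eh x Hx). fold W.
  specialize (Hode x Hx). rewrite cos_4_atan in Hode.
  assert (HC2' : (1 + RtoC x)%C <> 0) by (rewrite <- RtoC_plus; exact HC2).
  assert (HC3' : (1 - RtoC x)%C <> 0) by (rewrite <- RtoC_minus; exact HC3).
  assert (HC4' : (1 + RtoC x * RtoC x)%C <> 0) by (rewrite <- RtoC_mult, <- RtoC_plus; exact HC4).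
  assert (ID := adjoint_identity l nu (RtoC x) (RtoC (2 ^ n * x ^ (2 * n))) (W x) (g0 x) (g1 x) (g2 x)
    HC1 HC2' HC3' HC4').
  assert (Hx2 : 1 + x ^ 2 <> 0) by nra.
  assert (Hx1 : x <> 0) by lra.
  assert (Hx22 : (1 + x ^ 2) ^ 2 <> 0) by (apply pow_nonzero; exact Hx2).
  assert (Hx12 : x ^ 2 <> 0) by (apply pow_nonzero; exact Hx1).
  cbv zeta in ID. fold Z1 in ID.
  unfold moment_fun, Bk, Z. fold nu. fold W.
  replace (2 ^ n * x ^ S (S (2 * n + 1))) with (2 ^ n * x ^ (2 * n) * (x * x * x)).
  2: { replace (S (S (2 * n + 1))) with (2 * n + 3)%nat by lia. rewrite pow_add. ring. }
  replace (- 2 ^ n * x ^ S (S (2 * n))) with (- (2 ^ n * x ^ (2 * n)) * (x * x)) by (simpl; ring).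
  rewrite RtoC_mult.
  set (m := RtoC (2 ^ n * x ^ (2 * n))) in *.
  set (mm := 2 ^ n * x ^ (2 * n)) in *.
  clearbody mm.
  rewrite (RtoC_mult (- mm)), (RtoC_mult (- mm)), RtoC_opp. fold m.
  clearbody W Z1.
  match type of ID with ?P -> _ => assert (HP : P) end.
  { etransitivity; [|exact Hode].
    rewrite !RtoC_div by assumption. expand_RtoC. rewrite RtoC_div by assumption.
    expand_RtoC. field. split; [|exact HC1].
    replace (1 + RtoC x ^ 2)%C with (1 + RtoC x * RtoC x)%C by ring. exact HC4'. }
  specialize (ID HP).
  set (Br := (4 * nu * (2 * nu + 3) * (1 + RtoC x * RtoC x) / (2 * (RtoC x * RtoC x)) - _ + _)%C) in *.
  replace (m * RtoC (x * x * x) * (W x * g0 x) * Br)%C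
    with (- (- (m * (RtoC x * RtoC x * RtoC x) * W x * g0 x) * Br))%C by (expand_RtoC; ring).
  rewrite <- ID. clear ID. clearbody m. unfold nu in *. expand_RtoC. field.
  split; [|exact HC2'].
  replace (1 + RtoC x ^ 2)%C with (1 + RtoC x * RtoC x)%C by ring. exact HC4'.
Qed.

Lemma moments_recurrence (l : C) (g0 g1 g2 g3 : R -> C) :
  0 <= Re l -> jet g0 g1 g2 -> jet g1 g2 g3 -> mode_ode l g0 g1 g2 ->
  mode_recurrence l (fun n => pairing l (moment_fun l g0 n)).
Proof.
  intros Hl J0 J1 Hode.
  assert (Cg : C2 g0) by (do 2 eexists; exact J0).
  assert (HF := fun n => flat_moment_fun l g0 n Cg).
  assert (HX : forall x, 0 < x < 1 -> RtoC x <> 0 /\ (1 + RtoC x * RtoC x <> 0)%C).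
  { intros x Hx. split; [apply RtoC_neq0; lra|].
    rewrite <- RtoC_mult, <- RtoC_plus. apply RtoC_neq0. nra. }
  assert (HS : forall n x, 0 < x < 1 -> moment_fun l g0 (S n) x =
    (2 * (RtoC x * RtoC x) / (1 + RtoC x * RtoC x) * moment_fun l g0 n x)%C).
  { intros n x Hx. rewrite moment_fun_S.
    unfold zeta. rewrite RtoC_div by nra. expand_RtoC. f_equal. f_equal; ring. }
  split.
  - assert (HV := pairing_moment_vanish l g0 g1 g2 g3
      (fun t => - ((l - 1) * (l + 9)) * moment_fun l g0 0 t + (l - 1) * (l + 5) * moment_fun l g0 1 t)%C
      0 Hl J0 J1 Hode (flat_lin _ _ _ _ (HF 0%nat) (HF 1%nat))).
    rewrite pairing_lin in HV by (try exact Hl; apply flat_C2, HF).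
    apply Ceq_minus. rewrite <- HV.
    + ring.
    + intros x Hx. destruct (HX x Hx) as [X1 X2]. rewrite (HS 0%nat x Hx). simpl (INR 0). field. split; assumption.
  - intro k. cbv zeta. set (nu := INR (S k)). set (m := (l + RtoC (2 * nu))%C).
    set (a := ((m - 1) * (m + 5))%C).
    set (b := (l * l + RtoC (8 * nu + 8) * l + RtoC (12 * nu ^ 2 + 20 * nu - 9))%C).
    set (c := RtoC (4 * nu * (2 * nu + 3))).
    assert (HV := pairing_moment_vanish l g0 g1 g2 g3
      (fun t => a * moment_fun l g0 (S (S k)) t
                + 1 * (- b * moment_fun l g0 (S k) t + c * moment_fun l g0 k t))%C
      (S k) Hl J0 J1 Hode (flat_lin _ _ _ _ (HF _) (flat_lin _ _ _ _ (HF _) (HF _)))).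
    rewrite (pairing_lin l a 1 _ _ Hl (flat_C2 _ (HF _)) (flat_C2 _ (flat_lin (- b) c _ _ (HF _) (HF _)))) in HV.
    rewrite (pairing_lin l (- b) c _ _ Hl (flat_C2 _ (HF _)) (flat_C2 _ (HF _))) in HV.
    apply Ceq_minus. rewrite <- HV.
    + ring.
    + intros x Hx. destruct (HX x Hx) as [X1 X2]. rewrite (HS (S k) x Hx), (HS k x Hx).
      unfold a, b, c, m. fold nu. expand_RtoC. field. split; assumption.
Qed.

Definition second_diff_kernel (l : C) (g : R -> C) (t : R) : C :=
  (end_weight l t * (RtoC ((1 + t) ^ 2) * (log_weight 0 (- (2)) t * moment_fun l g 0 t)))%C.

Lemma cC_second_diff_kernel (l : C) (g : R -> C) : 0 <= Re l -> cC g -> cC (second_diff_kernel l g).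
Proof.
  intros Hl Hg.
  assert (P1 : cC (fun t => RtoC ((1 + t) ^ 2))).
  { apply cC_RtoC. intro x. apply (ex_derive_continuous (V := R_NormedModule)). auto_derive; exact I. }
  assert (P2 : cC (fun t => RtoC (2 ^ 0 * t ^ S (S (2 * 0 + 1))))).
  { apply cC_RtoC. intro x. apply (ex_derive_continuous (V := R_NormedModule)). auto_derive; exact I. }
  assert (P3 := cC_end_weight l Hl).
  unfold second_diff_kernel, moment_fun. solve_cC.
Qed.

(* The second difference inserts the factor [(1 - zeta)^2], which cancels the singularity of the weight at 1
   and undoes the regularisation. *)
Lemma second_diff_moments (l : C) (g : R -> C) (n : nat) :
  0 <= Re l -> C2 g ->
  (pairing l (moment_fun l g n) - 2 * pairing l (moment_fun l g (S n)) + pairing l (moment_fun l g (S (S n)))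
   = l * (l + 1) * CInt (fun t => RtoC (zeta t ^ n) * second_diff_kernel l g t))%C.
Proof.
  intros Hl Hg.
  assert (HF := fun n => flat_moment_fun l g n Hg).
  set (h := fun t => (1 * moment_fun l g n t
      + 1 * (- (2) * moment_fun l g (S n) t + 1 * moment_fun l g (S (S n)) t))%C).
  assert (Hh : flat h) by exact (flat_lin _ _ _ _ (HF _) (flat_lin _ _ _ _ (HF _) (HF _))).
  set (k := fun t => (RtoC ((1 + t) ^ 2) * (log_weight 0 (- (2)) t * moment_fun l g n t))%C).
  assert (Hk : C2 k).
  { apply C2_mult; [|apply C2_mult; [exact (C2_log_weight _ _) | apply flat_C2, HF]].
    exists (fun t => RtoC (2 * (1 + t))), (fun t => RtoC 2).
    apply (jet_RtoC (fun t => (1 + t) ^ 2) (fun t => 2 * (1 + t)) (fun _ => 2)); intro x.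
    - auto_derive; [exact I | ring].
    - auto_derive; [exact I | ring].
    - apply continuous_const. }
  transitivity (pairing l h).
  { unfold h.
    rewrite (pairing_lin l 1 1 _ _ Hl (flat_C2 _ (HF _)) (flat_C2 _ (flat_lin (- (2)) 1 _ _ (HF _) (HF _)))).
    rewrite (pairing_lin l (- (2)) 1 _ _ Hl (flat_C2 _ (HF _)) (flat_C2 _ (HF _))). ring. }
  destruct Hh as (h1 & h2 & Hh & Hh0). destruct Hk as (k1 & k2 & Hk).
  rewrite (pairing_double l h h1 h2 k k1 k2 Hl Hh Hk Hh0).
  - f_equal. apply CInt_ext. intros x Hx. unfold k, second_diff_kernel.
    rewrite (moment_fun_pow l g n x). ring.
  - unfold k, moment_fun. replace (2 ^ n * 0 ^ S (S (2 * n + 1))) with 0 by (simpl; ring). ring.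
  - intros x Hx. unfold h, k. rewrite !moment_fun_S.
    assert (E2 : (log_weight 0 (- (2)) x * (RtoC (1 + x ^ 2) * RtoC (1 + x ^ 2)))%C = 1).
    { rewrite <- log_weight_0_1, <- !log_weight_plus. unfold log_weight.
      replace ((0 + (0 + 0)) * RtoC (ln (1 + Rabs x)) + (- (2) + (1 + 1)) * RtoC (ln (1 + x ^ 2)))%C
        with (RtoC 0) by ring.
      rewrite cexp_RtoC, exp_0. reflexivity. }
    assert (N2 : RtoC (1 + x ^ 2) <> 0) by (apply RtoC_neq0; nra).
    replace (log_weight 0 (- (2)) x) with (1 / (RtoC (1 + x ^ 2) * RtoC (1 + x ^ 2)))%C
      by (rewrite <- E2; field; exact N2).
    unfold zeta. rewrite RtoC_div by nra. revert N2. expand_RtoC. intro N2. field. exact N2.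
Qed.

Lemma cC_bounded (f : R -> C) : cC f -> exists M, forall x, 0 <= x <= 1 -> Cmod (f x) <= M.
Proof.
  intro Hf.
  destruct (continuity_ab_maj (fun x => Rabs (Re (f x)) + Rabs (Im (f x))) 0 1) as [c [Hc _]]; [lra| |].
  - intros x _. apply continuity_pt_filterlim. destruct (Hf x) as [H1 H2].
    apply (continuous_plus (V := R_NormedModule) (fun t => Rabs (Re (f t))) (fun t => Rabs (Im (f t)))).
    + apply (continuous_comp (fun t => Re (f t)) Rabs); [exact H1 | apply continuous_Rabs].
    + apply (continuous_comp (fun t => Im (f t)) Rabs); [exact H2 | apply continuous_Rabs].
  - eexists. intros x Hx. eapply Rle_trans; [|exact (Hc x Hx)].
    replace (f x) with (RtoC (Re (f x)) + Ci * RtoC (Im (f x)))%C.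
    2: { apply injective_projections; cbn; unfold Re, Im; ring. }
    eapply Rle_trans; [apply Cmod_triangle|]. rewrite Cmod_mult, Cmod_Ci, !Cmod_R.
    rewrite Rmult_1_l. apply Req_le. f_equal; f_equal; cbn; unfold Re, Im; ring.
Qed.

Lemma zeta_bounds (x : R) : 0 <= x <= 1 -> 0 <= zeta x <= 1.
Proof.
  intro Hx. unfold zeta. assert (0 < 1 + x ^ 2) by nra.
  split.
  - apply Rmult_le_pos; [nra | left; apply Rinv_0_lt_compat; lra].
  - apply Rmult_le_reg_r with (1 + x ^ 2); [lra|]. unfold Rdiv.
    rewrite Rmult_assoc, Rinv_l by lra. nra.
Qed.

Lemma second_diff_moments_bounded (l : C) (g : R -> C) :
  0 <= Re l -> C2 g -> exists M, forall n,
  Cmod (pairing l (moment_fun l g n) - 2 * pairing l (moment_fun l g (S n))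
        + pairing l (moment_fun l g (S (S n))))%C <= M.
Proof.
  intros Hl Hg.
  assert (Hc : cC g) by (destruct Hg as (? & ? & H & _); exact H).
  assert (HK := cC_second_diff_kernel l g Hl Hc).
  destruct (cC_bounded _ HK) as [M HM].
  exists (Cmod (l * (l + 1)) * (2 * M)). intro n.
  rewrite second_diff_moments by assumption. rewrite Cmod_mult.
  apply Rmult_le_compat_l; [apply Cmod_ge_0|].
  apply Cmod_CInt_le.
  - apply cC_mult; [|exact HK]. apply cC_RtoC. intro x.
    apply (ex_derive_continuous (V := R_NormedModule)). unfold zeta. auto_derive. nra.
  - intros x Hx. rewrite Cmod_mult, Cmod_R.
    destruct (zeta_bounds x Hx) as [B0 B1].
    rewrite Rabs_pos_eq by (apply pow_le; exact B0).
    rewrite <- (Rmult_1_l M). apply Rmult_le_compat; [apply pow_le; exact B0 | apply Cmod_ge_0 | | apply HM, Hx].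
    apply Rle_trans with (1 ^ n); [apply pow_incr; split; assumption | rewrite pow1; apply Rle_refl].
Qed.

(** * Vanishing moments *)

Lemma continuous_zeta (x : R) : continuous zeta x.
Proof. apply (ex_derive_continuous (V := R_NormedModule)). unfold zeta. auto_derive. nra. Qed.

Lemma zeta_diff (x y : R) : zeta y - zeta x = 2 * (y + x) / ((1 + y ^ 2) * (1 + x ^ 2)) * (y - x).
Proof. unfold zeta. field. split; nra. Qed.

Lemma zeta_separation (x y : R) :
  0 <= x <= 1 -> 0 <= y <= 1 -> x / 2 * Rabs (y - x) <= Rabs (zeta y - zeta x) <= 4 * Rabs (y - x).
Proof.
  intros Hx Hy. rewrite zeta_diff, Rabs_mult.
  assert (HX : 0 <= x ^ 2 <= 1) by nra. assert (HY : 0 <= y ^ 2 <= 1) by nra.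
  assert (HD : 1 <= (1 + y ^ 2) * (1 + x ^ 2) <= 4) by (split; nra).
  set (D := (1 + y ^ 2) * (1 + x ^ 2)) in *.
  assert (Hq : x / 2 <= 2 * (y + x) / D <= 4).
  { split.
    - apply Rmult_le_reg_r with D; [lra|]. unfold Rdiv at 2. rewrite (Rmult_assoc _ (/ D)), Rinv_l by lra. nra.
    - apply Rmult_le_reg_r with D; [lra|]. unfold Rdiv. rewrite (Rmult_assoc _ (/ D)), Rinv_l by lra. nra. }
  rewrite (Rabs_pos_eq (2 * (y + x) / D)) by lra.
  pose proof (Rabs_pos (y - x)). split; apply Rmult_le_compat_r; lra.
Qed.

Lemma RInt_lin3 (a b c : R) (u v w : R -> R) :
  ex_RInt u 0 1 -> ex_RInt v 0 1 -> ex_RInt w 0 1 ->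
  RInt (fun t => a * u t + b * v t + c * w t) 0 1 = a * RInt u 0 1 + b * RInt v 0 1 + c * RInt w 0 1.
Proof.
  intros Hu Hv Hw. apply (is_RInt_unique (V := R_CompleteNormedModule)).
  apply (is_RInt_plus (V := R_NormedModule) (fun t => a * u t + b * v t) (fun t => c * w t)).
  - apply (is_RInt_plus (V := R_NormedModule) (fun t => a * u t) (fun t => b * v t));
      apply (is_RInt_scal (V := R_NormedModule)); apply (RInt_correct (V := R_CompleteNormedModule)); assumption.
  - apply (is_RInt_scal (V := R_NormedModule)), (RInt_correct (V := R_CompleteNormedModule)), Hw.
Qed.

(* If [h x > 0], the integrals of [h] against powers of a quadratic polynomial in [zeta] that peaks
   at [zeta x] are unbounded. *)
Lemma zeta_moments_determine_nonpos (h : R -> R) :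
  (forall x, continuous h x) ->
  (forall n, RInt (fun t => zeta t ^ n * h t) 0 1 = 0) ->
  forall x, 0 < x < 1 -> h x <= 0.
Proof.
  intros Hc Hm x Hx. destruct (Rle_lt_dec (h x) 0) as [|Hpos]; [assumption|]. exfalso.
  assert (Hloc : locally x (fun t => h x / 2 < h t)).
  { apply (Hc x). apply (open_gt (h x / 2) (h x)). lra. }
  destruct (filter_and _ _ Hloc (locally_open_unit x Hx)) as [d Hd].
  set (e := x / 2 * d).
  assert (Hdp := cond_pos d).
  assert (He : 0 < e) by (unfold e; nra).
  set (q := fun t => (1 + e ^ 2 / 2 - zeta x ^ 2) + 2 * zeta x * zeta t + (-1) * zeta t ^ 2).
  assert (Hq : forall t, q t = 1 + e ^ 2 / 2 - (zeta t - zeta x) ^ 2) by (intro; unfold q; ring).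
  assert (Hcq : forall t, continuous q t).
  { intro t. apply (ex_derive_continuous (V := R_NormedModule)). unfold q, zeta. auto_derive.
    repeat split; nra. }
  assert (Hcp : forall (u : R -> R) n, (forall t, continuous u t) -> forall t, continuous (fun t => u t ^ n) t).
  { intros u n Hu t. induction n as [|n IH]; [apply continuous_const|].
    apply (continuous_mult (K := R_AbsRing) u (fun t => u t ^ n)); [apply Hu | exact IH]. }
  assert (Hcm : forall u v : R -> R, (forall t, continuous u t) -> (forall t, continuous v t) ->
    forall t, continuous (fun t => u t * v t) t).
  { intros u v Hu Hv t. apply (continuous_mult (K := R_AbsRing) u v); auto. }
  assert (Hqm : forall m n, RInt (fun t => zeta t ^ n * (q t ^ m * h t)) 0 1 = 0).
  { induction m as [|m IH]; intro n.
    - transitivity (RInt (fun t => zeta t ^ n * h t) 0 1); [|apply Hm].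
      apply RInt_ext. intros; simpl; ring.
    - assert (Hex : forall k, ex_RInt (fun t => zeta t ^ k * (q t ^ m * h t)) 0 1).
      { intro k. apply ex_RInt_of_continuous. apply Hcm; [apply Hcp, continuous_zeta|].
        apply Hcm; [apply Hcp, Hcq | exact Hc]. }
      transitivity (RInt (fun t => (1 + e ^ 2 / 2 - zeta x ^ 2) * (zeta t ^ n * (q t ^ m * h t))
          + 2 * zeta x * (zeta t ^ S n * (q t ^ m * h t))
          + (-1) * (zeta t ^ S (S n) * (q t ^ m * h t))) 0 1).
      { apply RInt_ext. intros t _. simpl pow. generalize (q t ^ m). intro Q. unfold q.
        match goal with |- ?a = ?b => change (@eq R a b) end. field. }
      rewrite (RInt_lin3 _ _ _ _ _ _ (Hex n) (Hex (S n)) (Hex (S (S n)))), !IH.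
      match goal with |- ?a = ?b => change (@eq R a b) end. ring. }
  destruct (continuity_ab_min h 0 1) as [c [Hmin _]]; [lra| intros; apply continuity_pt_filterlim, Hc |].
  set (M := Rabs (h c)).
  assert (HM : forall t, 0 <= t <= 1 -> - M <= h t).
  { intros t Ht. specialize (Hmin t Ht). unfold M. pose proof (Rle_abs (- h c)). rewrite Rabs_Ropp in H. lra. }
  assert (HM0 : 0 <= M) by apply Rabs_pos.
  assert (Hz : forall t, 0 <= t <= 1 -> 0 <= zeta t <= 1) by (intros; apply zeta_bounds; assumption).
  assert (Hq0 : forall t, 0 <= t <= 1 -> 0 <= q t).
  { intros t Ht. rewrite Hq. assert (Hzt := Hz t Ht). assert (Hzx := Hz x ltac:(lra)).
    assert ((zeta t - zeta x) ^ 2 <= 1) by nra. nra. }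
  assert (Hlow : forall m t, 0 <= t <= 1 -> - M <= q t ^ m * h t).
  { intros m t Ht. assert (P0 : 0 <= q t ^ m) by (apply pow_le, Hq0, Ht).
    destruct (Rlt_le_dec (Rabs (t - x)) d) as [Hlt|Hge].
    - assert (h x / 2 < h t) by (apply Hd, Hlt). nra.
    - assert (HS := proj1 (zeta_separation x t ltac:(lra) Ht)).
      assert (He2 : e <= Rabs (zeta t - zeta x)) by (unfold e; nra).
      assert (e ^ 2 <= (zeta t - zeta x) ^ 2) by (rewrite <- (pow2_abs (zeta t - zeta x)); apply pow_incr; lra).
      assert (Q1 : q t ^ m <= 1).
      { apply Rle_trans with (1 ^ m); [|rewrite pow1; apply Rle_refl].
        apply pow_incr. split; [apply Hq0, Ht|]. rewrite Hq. pose proof (pow2_ge_0 e). lra. }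
      specialize (HM t Ht). nra. }
  set (d' := Rmin (d / 2) (e / 8)).
  assert (Hd' : 0 < d') by (apply Rmin_pos; lra).
  assert (Hd'1 : d' <= d / 2) by apply Rmin_l.
  assert (Hd'2 : d' <= e / 8) by apply Rmin_r.
  assert (Hin : forall t, x - d' <= t <= x + d' -> h x / 2 < h t /\ 0 < t < 1).
  { intros t Ht. apply (Hd t). change (Rabs (t - x) < d). apply Rabs_def1; lra. }
  assert (HI0 := Hin (x - d') ltac:(lra)). assert (HI1 := Hin (x + d') ltac:(lra)).
  assert (Hpeak : forall m t, x - d' <= t <= x + d' -> (1 + e ^ 2 / 4) ^ m * (h x / 2) <= q t ^ m * h t).
  { intros m t Ht. destruct (Hin t Ht) as [Ht1 Ht2].
    assert (HS := proj2 (zeta_separation x t ltac:(lra) ltac:(lra))).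
    assert (Rabs (t - x) <= d') by (apply Rabs_le; lra).
    assert ((zeta t - zeta x) ^ 2 <= (e / 2) ^ 2).
    { rewrite <- (pow2_abs (zeta t - zeta x)). apply pow_incr. split; [apply Rabs_pos | lra]. }
    assert ((1 + e ^ 2 / 4) ^ m <= q t ^ m).
    { apply pow_incr. rewrite Hq. split; nra. }
    assert (0 <= (1 + e ^ 2 / 4) ^ m) by (apply pow_le; nra).
    nra. }
  assert (Hcqh : forall m t, continuous (fun t => q t ^ m * h t) t).
  { intro m. apply Hcm; [apply Hcp, Hcq | exact Hc]. }
  assert (Hbound : forall m, 2 * d' * ((1 + e ^ 2 / 4) ^ m * (h x / 2)) <= M).
  { intro m.
    assert (E0 : RInt (fun t => q t ^ m * h t) 0 1 = 0).
    { transitivity (RInt (fun t => zeta t ^ 0 * (q t ^ m * h t)) 0 1); [|apply Hqm].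
      apply RInt_ext. intros; simpl; ring. }
    assert (Hex := fun a b => ex_RInt_of_continuous (fun t => q t ^ m * h t) a b (Hcqh m)).
    assert (Hge : forall a b k, a <= b -> (forall t, a < t < b -> k <= q t ^ m * h t) ->
      (b - a) * k <= RInt (fun t => q t ^ m * h t) a b).
    { intros a b k Hab Hk.
      replace ((b - a) * k) with (RInt (fun _ => k) a b) by (rewrite RInt_const; reflexivity).
      apply RInt_le; [exact Hab | apply ex_RInt_const | apply Hex | exact Hk]. }
    rewrite <- (RInt_Chasles (V := R_CompleteNormedModule) _ 0 (x - d') 1) in E0 by apply Hex.
    rewrite <- (RInt_Chasles (V := R_CompleteNormedModule) _ (x - d') (x + d') 1) in E0 by apply Hex.
    assert (I1 := Hge 0 (x - d') (- M) ltac:(lra) (fun t Ht => Hlow m t ltac:(lra))).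
    assert (I2 := Hge (x - d') (x + d') _ ltac:(lra) (fun t Ht => Hpeak m t ltac:(lra))).
    assert (I3 := Hge (x + d') 1 (- M) ltac:(lra) (fun t Ht => Hlow m t ltac:(lra))).
    unfold plus in E0; simpl in E0. nra. }
  set (A := d' * h x).
  assert (HA : 0 < A) by (unfold A; nra).
  assert (He2 : 0 < e ^ 2) by (apply pow_lt, He).
  assert (HG : 0 < A * (e ^ 2 / 4)) by (apply Rmult_lt_0_compat; lra).
  destruct (nfloor_ex (M / (A * (e ^ 2 / 4)))) as [m [_ Hmm]].
  { apply Rmult_le_pos; [exact HM0|]. left. apply Rinv_0_lt_compat, HG. }
  specialize (Hbound (S m)).
  assert (HB := Rle_pow_lin (e ^ 2 / 4) (S m) ltac:(lra)). rewrite S_INR in HB.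
  assert (Hk : M < (INR m + 1) * (A * (e ^ 2 / 4))).
  { set (G := A * (e ^ 2 / 4)) in *. replace M with (M / G * G) by (field; lra).
    apply Rmult_lt_compat_r; assumption. }
  replace (2 * d' * ((1 + e ^ 2 / 4) ^ S m * (h x / 2))) with (A * (1 + e ^ 2 / 4) ^ S m) in Hbound
    by (unfold A; field).
  nra.
Qed.

Lemma zeta_moments_determine (h : R -> R) :
  (forall x, continuous h x) ->
  (forall n, RInt (fun t => zeta t ^ n * h t) 0 1 = 0) ->
  forall x, 0 < x < 1 -> h x = 0.
Proof.
  intros Hc Hm x Hx. apply Rle_antisym; [exact (zeta_moments_determine_nonpos h Hc Hm x Hx)|].
  assert (Ho : forall t, continuous (fun t => - h t) t).
  { intro t. apply (continuous_opp (V := R_NormedModule)), Hc. }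
  assert (H := zeta_moments_determine_nonpos (fun t => - h t) Ho).
  assert (- h x <= 0); [|lra]. apply H; [|exact Hx]. intro n.
  transitivity (RInt (fun t => opp (zeta t ^ n * h t)) 0 1).
  { apply RInt_ext. intros t _. unfold opp; simpl. ring. }
  rewrite (RInt_opp (V := R_CompleteNormedModule)).
  - rewrite Hm. unfold opp; simpl. ring.
  - apply ex_RInt_of_continuous. intro t.
    apply (continuous_mult (K := R_AbsRing) (fun t => zeta t ^ n) h); [|apply Hc].
    apply (ex_derive_continuous (V := R_NormedModule)). unfold zeta. auto_derive. nra.
Qed.

Lemma complex_zeta_moments_determine (h : R -> C) :
  cC h -> (forall n, CInt (fun t => RtoC (zeta t ^ n) * h t)%C = 0) ->
  forall x, 0 < x < 1 -> h x = 0.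
Proof.
  intros Hc Hm x Hx. apply injective_projections.
  - apply (zeta_moments_determine (fun t => Re (h t)) (fun t => proj1 (Hc t))); [|exact Hx].
    intro n. transitivity (Re (CInt (fun t => RtoC (zeta t ^ n) * h t)%C)); [|rewrite Hm; reflexivity].
    apply RInt_ext. intros t _. rewrite re_scal_l. reflexivity.
  - apply (zeta_moments_determine (fun t => Im (h t)) (fun t => proj2 (Hc t))); [|exact Hx].
    intro n. transitivity (Im (CInt (fun t => RtoC (zeta t ^ n) * h t)%C)); [|rewrite Hm; reflexivity].
    apply RInt_ext. intros t _. rewrite im_scal_l. reflexivity.
Qed.

(** * The case lambda = 0 and the conclusion *)

Lemma zero_on_closure (P : R -> R) :
  (forall x, continuous P x) -> (forall x, 0 < x < 1 -> P x = 0) ->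
  forall x, 0 <= x <= 1 -> P x = 0.
Proof.
  intros Hc H0 x Hx. destruct (Req_dec (P x) 0) as [|Hn]; [assumption|]. exfalso.
  assert (HL : locally x (fun t => P t <> 0)) by exact (Hc x (fun y => y <> 0) (open_neq 0 (P x) Hn)).
  destruct HL as [d Hd]. assert (Hdp := cond_pos d).
  assert (Hn' : forall t, Rabs (t - x) < d -> P t <> 0) by (intros t Ht; apply Hd, Ht).
  set (r := Rmin d (1 / 2)).
  assert (Hr : 0 < r) by (apply Rmin_pos; lra).
  assert (Hr1 : r <= d) by apply Rmin_l. assert (Hr2 : r <= 1 / 2) by apply Rmin_r.
  destruct (Rle_lt_dec x (1 / 2)).
  - apply (Hn' (x + r / 2)); [apply Rabs_def1; lra | apply H0; lra].
  - apply (Hn' (x - r / 2)); [apply Rabs_def1; lra | apply H0; lra].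
Qed.

Lemma continuous_bounded (u : R -> R) : (forall x, continuous u x) ->
  exists L, 0 <= L /\ forall x, 0 <= x <= 1 -> Rabs (u x) <= L.
Proof.
  intro Hu. destruct (continuity_ab_maj (fun x => Rabs (u x)) 0 1) as [c [Hc _]]; [lra| |].
  - intros x _. apply continuity_pt_filterlim.
    apply (continuous_comp u Rabs); [apply Hu | apply continuous_Rabs].
  - exists (Rabs (u c)). split; [apply Rabs_pos | exact Hc].
Qed.

(* Comparison with the eigenfunction [x / (1 + x^2)] of [l = 1]: in Liouville normal form that one is
   [x^2 (1 - x^2)^(1/2) / (1 + x^2)], with logarithmic derivative [c = 2/x - x/(1-x^2) - 2x/(1+x^2)]. For
   [v = x u] the function [Phi = v v' - c v^2] is nondecreasing and vanishes at both ends. *)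
Lemma no_zero_mode (u u1 u2 : R -> R) :
  (forall x, continuous u x) -> (forall x, continuous u1 x) -> (forall x, continuous u2 x) ->
  (forall x, 0 < x < 1 -> is_derive u x (u1 x)) -> (forall x, 0 < x < 1 -> is_derive u1 x (u2 x)) ->
  (forall x, 0 < x < 1 ->
     - ((1 - x ^ 2) * u2 x) - 2 / x * u1 x + 2 * x * u1 x
     + 2 * ((1 - 6 * x ^ 2 + x ^ 4) / (1 + x ^ 2) ^ 2) / x ^ 2 * u x = 0) ->
  forall x, 0 < x < 1 -> u x = 0.
Proof.
  intros C0 C1 C2' D0 D1 Hode.
  assert (Hu1 : u 1 = 0).
  { set (P := fun x => - ((1 - x ^ 2) * x ^ 2 * (1 + x ^ 2) ^ 2 * u2 x)
      - 2 * x * (1 - x ^ 2) * (1 + x ^ 2) ^ 2 * u1 x + 2 * (1 - 6 * x ^ 2 + x ^ 4) * u x).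
    assert (HP : P 1 = 0); [|unfold P in HP; lra].
    apply zero_on_closure; [| |lra].
    - intro x. unfold P.
      assert (Hpoly : forall p : R -> R, ex_derive p x -> continuous p x)
        by (intro p; apply (ex_derive_continuous (V := R_NormedModule))).
      apply (continuous_plus (V := R_NormedModule)
        (fun x => - ((1 - x ^ 2) * x ^ 2 * (1 + x ^ 2) ^ 2 * u2 x) - 2 * x * (1 - x ^ 2) * (1 + x ^ 2) ^ 2 * u1 x)
        (fun x => 2 * (1 - 6 * x ^ 2 + x ^ 4) * u x)).
      + apply (continuous_minus (V := R_NormedModule)
          (fun x => - ((1 - x ^ 2) * x ^ 2 * (1 + x ^ 2) ^ 2 * u2 x))
          (fun x => 2 * x * (1 - x ^ 2) * (1 + x ^ 2) ^ 2 * u1 x)).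
        * apply (continuous_opp (V := R_NormedModule) (fun x => (1 - x ^ 2) * x ^ 2 * (1 + x ^ 2) ^ 2 * u2 x)).
          apply (continuous_mult (K := R_AbsRing) (fun x => (1 - x ^ 2) * x ^ 2 * (1 + x ^ 2) ^ 2) u2); [|apply C2'].
          apply Hpoly. auto_derive. exact I.
        * apply (continuous_mult (K := R_AbsRing) (fun x => 2 * x * (1 - x ^ 2) * (1 + x ^ 2) ^ 2) u1); [|apply C1].
          apply Hpoly. auto_derive. exact I.
      + apply (continuous_mult (K := R_AbsRing) (fun x => 2 * (1 - 6 * x ^ 2 + x ^ 4)) u); [|apply C0].
        apply Hpoly. auto_derive. exact I.
    - intros x Hx. specialize (Hode x Hx). unfold P.
      replace 0 with (x ^ 2 * (1 + x ^ 2) ^ 2 * 0) by ring. rewrite <- Hode. field. split; nra. }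
  set (Phi := fun x => x * u x * (u x + x * u1 x)
    - (2 * x - x ^ 3 / (1 - x ^ 2) - 2 * x ^ 3 / (1 + x ^ 2)) * u x ^ 2).
  set (c := fun x => 2 / x - x / (1 - x ^ 2) - 2 * x / (1 + x ^ 2)).
  set (dPhi := fun x => (u x + x * u1 x - c x * (x * u x)) ^ 2 + (x * u x) ^ 2 / (1 - x ^ 2) ^ 2).
  assert (HdPhi : forall x, 0 < x < 1 -> is_derive Phi x (dPhi x)).
  { intros x Hx.
    assert (E0 : Derive (fun t => u t) x = u1 x) by exact (is_derive_unique _ _ _ (D0 x Hx)).
    assert (E1 : Derive (fun t => u1 t) x = u2 x) by exact (is_derive_unique _ _ _ (D1 x Hx)).
    assert (N1 : 1 - x ^ 2 <> 0) by nra. assert (N2 : 1 + x ^ 2 <> 0) by nra.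
    unfold Phi. auto_derive.
    - assert (X0 : ex_derive u x) by (eexists; exact (D0 x Hx)).
      assert (X1 : ex_derive u1 x) by (eexists; exact (D1 x Hx)).
      repeat split; solve [exact X0 | exact X1 | exact N1 | exact N2 | simpl in *; lra].
    - rewrite E0, E1.
      assert (Eu2 : u2 x = (- (2 / x * u1 x) + 2 * x * u1 x
        + 2 * ((1 - 6 * x ^ 2 + x ^ 4) / (1 + x ^ 2) ^ 2) / x ^ 2 * u x) / (1 - x ^ 2)).
      { apply Rmult_eq_reg_r with (1 - x ^ 2); [|exact N1]. specialize (Hode x Hx).
        unfold Rdiv at 1. rewrite Rmult_assoc, Rinv_l by exact N1. lra. }
      rewrite Eu2. unfold dPhi, c. field. repeat split; simpl in *; lra. }
  assert (HdPhi0 : forall x, 0 < x < 1 -> (x * u x) ^ 2 / (1 - x ^ 2) ^ 2 <= dPhi x).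
  { intros x Hx. unfold dPhi. pose proof (pow2_ge_0 (u x + x * u1 x - c x * (x * u x))). lra. }
  assert (Hsq : forall x, 0 < x < 1 -> 0 <= (x * u x) ^ 2 / (1 - x ^ 2) ^ 2).
  { intros x Hx. apply Rmult_le_pos; [apply pow2_ge_0|]. left. apply Rinv_0_lt_compat, pow_lt. nra. }
  assert (Hmono : forall a b, 0 < a -> a < b -> b < 1 -> Phi a <= Phi b).
  { intros a b Ha Hab Hb.
    destruct (MVT_gen Phi a b dPhi) as [t [Ht E]].
    - rewrite Rmin_left, Rmax_right by lra. intros x Hx. apply HdPhi. lra.
    - rewrite Rmin_left, Rmax_right by lra. intros x Hx. apply continuity_pt_filterlim.
      apply (ex_derive_continuous (V := R_NormedModule)). eexists. apply HdPhi. lra.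
    - rewrite Rmin_left, Rmax_right in Ht by lra.
      assert (T1 := HdPhi0 t ltac:(lra)). assert (T2 := Hsq t ltac:(lra)). nra. }
  destruct (continuous_bounded u C0) as [L0 [HL0 B0]].
  destruct (continuous_bounded u1 C1) as [L1 [HL1 B1]].
  set (L := L0 + L1).
  assert (HL : 0 <= L) by (unfold L; lra).
  assert (B0' : forall x, 0 <= x <= 1 -> Rabs (u x) <= L) by (intros x Hx; specialize (B0 x Hx); unfold L; lra).
  assert (B1' : forall x, 0 <= x <= 1 -> Rabs (u1 x) <= L) by (intros x Hx; specialize (B1 x Hx); unfold L; lra).
  assert (Bend : forall x, 0 < x < 1 -> Rabs (u x) <= L * (1 - x)).
  { intros x Hx. destruct (MVT_gen u x 1 u1) as [t [Ht E]].
    - rewrite Rmin_left, Rmax_right by lra. intros y Hy. apply D0. lra.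
    - intros y _. apply continuity_pt_filterlim, C0.
    - rewrite Rmin_left, Rmax_right in Ht by lra. rewrite Hu1 in E.
      replace (u x) with (- (u1 t * (1 - x))) by lra.
      rewrite Rabs_Ropp, Rabs_mult, (Rabs_pos_eq (1 - x)) by lra.
      apply Rmult_le_compat_r; [lra | apply B1'; lra]. }
  assert (Hprod : forall x, 0 < x < 1 -> Rabs (u x * u1 x) <= L * L * (1 - x) /\ Rabs (u x * u1 x) <= L * L).
  { intros x Hx. rewrite Rabs_mult.
    assert (A1 := Bend x Hx). assert (A2 := B1' x ltac:(lra)). assert (A3 := B0' x ltac:(lra)).
    pose proof (Rabs_pos (u x)). pose proof (Rabs_pos (u1 x)).
    split; [replace (L * L * (1 - x)) with (L * (1 - x) * L) by ring|]; apply Rmult_le_compat; assumption. }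
  assert (Hsqr : forall x, 0 < x < 1 -> u x ^ 2 <= L * L * (1 - x) * (1 - x)).
  { intros x Hx. rewrite <- pow2_abs. replace (L * L * (1 - x) * (1 - x)) with ((L * (1 - x)) ^ 2) by ring.
    apply pow_incr. split; [apply Rabs_pos | apply Bend, Hx]. }
  assert (EPhi : forall x, 0 < x < 1 ->
    Phi x = - (x * u x ^ 2) + x ^ 2 * (u x * u1 x)
            + x ^ 3 * (u x ^ 2 / (1 - x ^ 2)) + 2 * (x ^ 3 * (u x ^ 2 / (1 + x ^ 2)))).
  { intros x Hx. unfold Phi. field. split; nra. }
  assert (Hpow : forall x, 0 < x < 1 -> 0 <= x ^ 2 <= x /\ 0 <= x ^ 3 <= 1).
  { intros x Hx. assert (0 <= x ^ 2 <= x) by nra. replace (x ^ 3) with (x * x ^ 2) by ring. split; nra. }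
  assert (Hfrac : forall x, 0 < x < 1 ->
    0 <= u x ^ 2 / (1 - x ^ 2) <= L * L * (1 - x) /\ 0 <= u x ^ 2 / (1 + x ^ 2) <= L * L * (1 - x)).
  { intros x Hx. destruct (Hpow x Hx) as [P2 _].
    assert (S2 := Hsqr x Hx). assert (S0 := pow2_ge_0 (u x)).
    assert (HLx : 0 <= L * L * (1 - x)) by (apply Rmult_le_pos; nra).
    split; split; try (apply Rmult_le_pos; [exact S0 | left; apply Rinv_0_lt_compat; lra]).
    - apply Rmult_le_reg_r with (1 - x ^ 2); [lra|]. unfold Rdiv. rewrite Rmult_assoc, Rinv_l by lra.
      rewrite Rmult_1_r. eapply Rle_trans; [exact S2|]. apply Rmult_le_compat_l; lra.
    - apply Rmult_le_reg_r with (1 + x ^ 2); [lra|]. unfold Rdiv. rewrite Rmult_assoc, Rinv_l by lra.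
      rewrite Rmult_1_r. eapply Rle_trans; [exact S2|]. apply Rmult_le_compat_l; lra. }
  assert (Hup : forall x, 0 < x < 1 -> Phi x <= 5 * (L * L) * (1 - x)).
  { intros x Hx. rewrite (EPhi x Hx). destruct (Hpow x Hx) as [P2 P3].
    destruct (Hfrac x Hx) as [F1 F2]. assert (R1 := proj1 (Hprod x Hx)).
    assert (HLx : 0 <= L * L * (1 - x)) by (apply Rmult_le_pos; nra).
    assert (T1 : 0 <= x * u x ^ 2) by (apply Rmult_le_pos; [lra | apply pow2_ge_0]).
    assert (T2 : x ^ 2 * (u x * u1 x) <= L * L * (1 - x)).
    { apply Rle_trans with (x ^ 2 * Rabs (u x * u1 x)).
      - apply Rmult_le_compat_l; [lra | apply Rle_abs].
      - rewrite <- (Rmult_1_l (L * L * (1 - x))). apply Rmult_le_compat; try lra. apply Rabs_pos. }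
    assert (T3 : x ^ 3 * (u x ^ 2 / (1 - x ^ 2)) <= L * L * (1 - x)).
    { rewrite <- (Rmult_1_l (L * L * (1 - x))). apply Rmult_le_compat; lra. }
    assert (T4 : x ^ 3 * (u x ^ 2 / (1 + x ^ 2)) <= L * L * (1 - x)).
    { rewrite <- (Rmult_1_l (L * L * (1 - x))). apply Rmult_le_compat; lra. }
    lra. }
  assert (Hlo : forall x, 0 < x < 1 -> - (2 * (L * L) * x) <= Phi x).
  { intros x Hx. rewrite (EPhi x Hx). destruct (Hpow x Hx) as [P2 P3].
    destruct (Hfrac x Hx) as [F1 F2]. assert (R1 := proj2 (Hprod x Hx)).
    assert (T1 : x * u x ^ 2 <= x * (L * L)).
    { apply Rmult_le_compat_l; [lra|]. rewrite <- pow2_abs. replace (L * L) with (L ^ 2) by ring.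
      apply pow_incr. split; [apply Rabs_pos | apply B0'; lra]. }
    assert (T2 : x ^ 2 * Rabs (u x * u1 x) <= x * (L * L)).
    { apply Rmult_le_compat; try lra. apply Rabs_pos. }
    assert (T2' : - (x ^ 2 * Rabs (u x * u1 x)) <= x ^ 2 * (u x * u1 x)).
    { rewrite <- Ropp_mult_distr_r_reverse. apply Rmult_le_compat_l; [lra|].
      pose proof (Rle_abs (- (u x * u1 x))) as HA. rewrite Rabs_Ropp in HA. lra. }
    assert (T3 : 0 <= x ^ 3 * (u x ^ 2 / (1 - x ^ 2))) by (apply Rmult_le_pos; lra).
    assert (T4 : 0 <= x ^ 3 * (u x ^ 2 / (1 + x ^ 2))) by (apply Rmult_le_pos; lra).
    lra. }
  assert (HPhi : forall x, 0 < x < 1 -> Phi x = 0).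
  { intros x Hx. set (K := 5 * (L * L) + 1).
    assert (HK : 1 <= K) by (unfold K; nra).
    apply Rle_antisym.
    - destruct (Rle_lt_dec (Phi x) 0) as [|Hp]; [assumption|]. exfalso.
      set (y := Rmax ((1 + x) / 2) (1 - Phi x / K)).
      assert (HPK : 0 < Phi x / K) by (apply Rdiv_lt_0_compat; lra).
      assert (Hy1 : (1 + x) / 2 <= y) by apply Rmax_l.
      assert (Hy2 : 1 - Phi x / K <= y) by apply Rmax_r.
      assert (Hy3 : y < 1) by (apply Rmax_lub_lt; lra).
      assert (A1 := Hmono x y ltac:(lra) ltac:(lra) Hy3).
      assert (A2 := Hup y ltac:(lra)).
      assert (A3 : K * (1 - y) <= Phi x).
      { replace (Phi x) with (K * (Phi x / K)) by (field; lra). apply Rmult_le_compat_l; lra. }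
      unfold K in A3. lra.
    - destruct (Rle_lt_dec 0 (Phi x)) as [|Hp]; [assumption|]. exfalso.
      set (y := Rmin (x / 2) (- Phi x / K)).
      assert (HPK : 0 < - Phi x / K) by (apply Rdiv_lt_0_compat; lra).
      assert (Hy1 : y <= x / 2) by apply Rmin_l.
      assert (Hy2 : y <= - Phi x / K) by apply Rmin_r.
      assert (Hy3 : 0 < y) by (apply Rmin_pos; lra).
      assert (A1 := Hmono y x Hy3 ltac:(lra) ltac:(lra)).
      assert (A2 := Hlo y ltac:(lra)).
      assert (A3 : K * y <= - Phi x).
      { replace (- Phi x) with (K * (- Phi x / K)) by (field; lra). apply Rmult_le_compat_l; lra. }
      unfold K in A3. nra. }
  intros x Hx.
  assert (Hd0 : dPhi x = 0).
  { rewrite <- (is_derive_unique _ _ _ (HdPhi x Hx)).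
    rewrite (Derive_ext_loc Phi (fun _ => 0)); [apply Derive_const|].
    eapply filter_imp; [|apply locally_open_unit, Hx]. exact HPhi. }
  assert (Hz := HdPhi0 x Hx). assert (Hz' := Hsq x Hx).
  assert (Hz2 : (x * u x) ^ 2 / (1 - x ^ 2) ^ 2 = 0) by lra.
  assert (Hv : (x * u x) ^ 2 = 0).
  { replace ((x * u x) ^ 2) with ((x * u x) ^ 2 / (1 - x ^ 2) ^ 2 * (1 - x ^ 2) ^ 2) by (field; nra).
    rewrite Hz2. ring. }
  destruct (Req_dec (u x) 0) as [|Hn]; [assumption|]. exfalso.
  apply (pow_nonzero (x * u x) 2); [apply Rmult_integral_contrapositive_currified; lra | exact Hv].
Qed.

Theorem theorem3p1 :
  forall lambda : C,
    (exists f : R -> C,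
       smooth_on_Icc 0 1 f /\
       (exists rho : R, 0 <= rho <= 1 /\ f rho <> RtoC 0) /\
       (forall rho : R, 0 < rho < 1 ->
          (- (RtoC (1 - rho ^ 2) * Derive_RC (Derive_RC f) rho)
           - RtoC (2 / rho) * Derive_RC f rho
           + RtoC 2 * (lambda + RtoC 1) * RtoC rho * Derive_RC f rho
           + RtoC (2 * cos (4 * atan rho) / rho ^ 2) * f rho
           + lambda * (lambda + RtoC 1) * f rho)%C = RtoC 0)) ->
    Re lambda < 0 \/ lambda = RtoC 1.
Proof.
  intros l [f [Hf [[rho [Hrho Hne]] Hode]]].
  destruct (Rlt_le_dec (Re l) 0) as [|Hl]; [left; assumption|].
  destruct (classic (l = RtoC 1)) as [|Hl1]; [right; assumption|]. exfalso.
  destruct (smooth_on_unit_jets f Hf) as (g0 & g1 & g2 & g3 & J0 & J1 & Hg).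
  assert (Hode' : mode_ode l g0 g1 g2).
  { intros x Hx. specialize (Hode x Hx).
    assert (Ef : forall t, 0 < t < 1 -> Derive_RC f t = g1 t).
    { intros t Ht. apply Derive_RC_eq. eapply dC_ext_loc; [|exact (proj1 (proj2 (proj2 (proj2 J0)) t Ht))].
      eapply filter_imp; [|apply locally_open_unit, Ht]. intros y Hy. apply Hg. lra. }
    assert (Ef2 : Derive_RC (Derive_RC f) x = g2 x).
    { apply Derive_RC_eq. eapply dC_ext_loc; [|exact (proj2 (proj2 (proj2 (proj2 J0)) x Hx))].
      eapply filter_imp; [|apply locally_open_unit, Hx]. intros y Hy. symmetry. apply Ef, Hy. }
    rewrite Ef2, (Ef x Hx), <- (Hg x) in Hode by lra. exact Hode. }
  apply Hne. rewrite <- (Hg rho Hrho).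
  assert (Hzero : forall x, 0 < x < 1 -> g0 x = 0).
  2: { destruct J0 as (C0 & _).
       apply injective_projections.
       - apply (zero_on_closure (fun t => Re (g0 t)) (fun t => proj1 (C0 t))); [|exact Hrho].
         intros x Hx. rewrite (Hzero x Hx). reflexivity.
       - apply (zero_on_closure (fun t => Im (g0 t)) (fun t => proj2 (C0 t))); [|exact Hrho].
         intros x Hx. rewrite (Hzero x Hx). reflexivity. }
  destruct (classic (l = RtoC 0)) as [E|Hl0].
  - subst l. destruct J0 as (C0 & C1 & C2' & D0).
    intros x Hx. apply injective_projections.
    + apply (no_zero_mode (fun t => Re (g0 t)) (fun t => Re (g1 t)) (fun t => Re (g2 t))
        (fun t => proj1 (C0 t)) (fun t => proj1 (C1 t)) (fun t => proj1 (C2' t))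
        (fun t Ht => proj1 (proj1 (D0 t Ht))) (fun t Ht => proj1 (proj2 (D0 t Ht)))); [|exact Hx].
      intros t Ht. specialize (Hode' t Ht). rewrite cos_4_atan in Hode'.
      apply (f_equal Re) in Hode'. cbn in Hode' |- *. unfold Re. lra.
    + apply (no_zero_mode (fun t => Im (g0 t)) (fun t => Im (g1 t)) (fun t => Im (g2 t))
        (fun t => proj2 (C0 t)) (fun t => proj2 (C1 t)) (fun t => proj2 (C2' t))
        (fun t Ht => proj2 (proj1 (D0 t Ht))) (fun t Ht => proj2 (proj2 (D0 t Ht)))); [|exact Hx].
      intros t Ht. specialize (Hode' t Ht). rewrite cos_4_atan in Hode'.
      apply (f_equal Im) in Hode'. cbn in Hode' |- *. unfold Im. lra.
  - assert (Cg : C2 g0) by (do 2 eexists; exact J0).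
    set (N := fun n => pairing l (moment_fun l g0 n)).
    assert (HN : mode_recurrence l N) by exact (moments_recurrence l g0 g1 g2 g3 Hl J0 J1 Hode').
    destruct (second_diff_moments_bounded l g0 Hl Cg) as [M HM].
    assert (HN0 : N 0%nat = 0).
    { destruct (classic (N 0%nat = 0)) as [|Hn]; [assumption|]. exfalso.
      destruct (mode_recurrence_growth l N Hl Hl1 HN Hn) as [n0 Hg0].
      exact (no_geometric_growth N M n0 HM Hg0). }
    assert (HNn := mode_recurrence_zero l N Hl Hl1 HN HN0).
    assert (Hll : (l * (l + 1) <> 0)%C).
    { apply Cmult_neq_0; [exact Hl0|]. apply neq0_of_Re_pos. rewrite re_plus, re_RtoC. lra. }
    intros x Hx.
    assert (HK : second_diff_kernel l g0 x = 0).
    { apply complex_zeta_moments_determine; [| |exact Hx].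
      - apply cC_second_diff_kernel; [exact Hl | exact (proj1 J0)].
      - intro n. assert (E := second_diff_moments l g0 n Hl Cg).
        change (pairing l (moment_fun l g0 n)) with (N n) in E.
        change (pairing l (moment_fun l g0 (S n))) with (N (S n)) in E.
        change (pairing l (moment_fun l g0 (S (S n)))) with (N (S (S n))) in E.
        rewrite !HNn in E.
        destruct (classic (CInt (fun t => RtoC (zeta t ^ n) * second_diff_kernel l g0 t)%C = 0)) as [|Hn];
          [assumption|].
        exfalso. apply (Cmult_neq_0 _ _ Hll Hn). rewrite <- E. ring. }
    destruct (classic (g0 x = 0)) as [|Hn]; [assumption|]. exfalso. revert HK.
    unfold second_diff_kernel, moment_fun.
    repeat apply Cmult_neq_0; try apply cexp_neq0; try exact Hn.
    + apply end_weight_neq0. lra.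
    + apply RtoC_neq0, pow_nonzero. lra.
    + apply RtoC_neq0, Rmult_integral_contrapositive_currified; apply pow_nonzero; lra.
Qed.
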